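(* Let $\mathcal{A}$ be a quasi-abelian category equipped with a rank function and a $\Lambda$-valued slope function $\mu$, where $\Lambda$ is a totally ordered, uniquely divisible abelian group. Then: (1) The category $W\mathcal{A}$ of mixed structures is abelian. (2) The inclusion $W\mathcal{A} \hookrightarrow \mathrm{Fun}(\Lambda,\mathcal{A})$ is (strongly) exact, i.e. it preserves short exact sequences and, more strongly, all kernels and cokernels.
   Context: All categories are essentially small. In an additive category with kernels and cokernels, put $\mathrm{Coim} f = \mathrm{Coker}(\ker f)$ and $\mathrm{Im} f = \mathrm{Ker}(\mathrm{coker} f)$; $f$ is strict if the canonical morphism $\mathrm{Coim} f \to \mathrm{Im} f$ is an isomorphism. Strict monics are exactly the kernels, strict epis exactly the cokernels. A sequence $0 \to M \xrightarrow{f} N \xrightarrow{g} P \to 0$ is short exact if $f = \ker g$ and $g = \mathrm{coker} f$. A quasi-abelian category is an additive category with kernels and cokernels in which kernels are stable under pushout and cokernels are stable under pullback. Slope functions. A rank function $\mathrm{rk}$ assigns to each isomorphism class of $\mathcal{A}$ a natural number, is additive along short exact sequences, and is nonzero on nonzero objects. A degree function $\deg$ assigns to each isomorphism class an element of $\Lambda$ and is additive along short exact sequences. $\mu = \deg/\mathrm{rk}$ (defined on nonzero objects) is a slope function if for every epi-monic $\varphi: M \to N$ in $\mathcal{A}$ one has $\mu(M) \leq \mu(N)$, with equality if and only if $\varphi$ is an isomorphism. A nonzero object $M$ is semistable if $\mu(N) \leq \mu(M)$ for all nonzero subobjects $N \to M$. $\mathcal{A}(\lambda) \subset \mathcal{A}$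 denotes the full subcategory consisting of zero and the semistable objects of slope $\lambda$. Filtrations. $\mathrm{Fun}(\Lambda,\mathcal{A})$ is the category of functors from the totally ordered set $\Lambda$ to $\mathcal{A}$. $W\mathcal{A}^{\mathrm{pre}} \subset \mathrm{Fun}(\Lambda,\mathcal{A})$ is the full subcategory of finite ascending filtrations: functors $\lambda \mapsto W_{\leq\lambda}M$ with colimit $M$ such that each $W_{\leq\lambda}M \to M$ is a strict monic and there are finitely many breaks $\lambda_0 < \dots < \lambda_r$ such that $W_{\leq\lambda}M = 0$ for $\lambda < \lambda_0$, $W_{\leq\lambda}M = W_{\leq\lambda_{i-1}}M$ for $\lambda_{i-1} \leq \lambda < \lambda_i$, and $W_{\leq\lambda}M = M$ for $\lambda \geq \lambda_r$ (no breaks if $M=0$). Objects are written $(M,W)$. Put $W_{<\lambda}M = \mathrm{colim}_{\lambda'<\lambda} W_{\leq\lambda'}M$ and $\mathrm{gr}^W_\lambda M = \mathrm{Coker}(W_{<\lambda}M \hookrightarrow W_{\leq\lambda}M)$. The category of mixed structures $W\mathcal{A} \subset W\mathcal{A}^{\mathrm{pre}}$ is the full subcategory of $(M,W)$ with $\mathrm{gr}^W_\lambda M \in \mathcal{A}(\lambda)$ for all $\lambda \in \Lambda$. *)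

(* Defs.v *)
From mathcomp Require Import all_boot all_order all_algebra.
From mathcomp Require Import boolp classical_sets.

Set Implicit Arguments.
Unset Strict Implicit.
Unset Printing Implicit Defensive.

Import Order.TTheory GRing.Theory.
Local Open Scope ring_scope.

Record category := Category {
  ob :> Type;
  hom : ob -> ob -> Type;
  idm : forall X, hom X X;
  comp : forall X Y Z, hom Y Z -> hom X Y -> hom X Z;
  comp_idl : forall X Y (f : hom X Y), comp (idm Y) f = f;
  comp_idr : forall X Y (f : hom X Y), comp f (idm X) = f;
  compA : forall X Y Z T (h : hom Z T) (g : hom Y Z) (f : hom X Y),
    comp h (comp g f) = comp (comp h g) f }.

Arguments hom {c} _ _.
Arguments idm {c} X.
Arguments comp {c X Y Z} _ _.

Notation "g \oc f" := (comp g f) (at level 40, left associativity).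

Record functor (C D : category) := Functor {
  fob :> C -> D;
  fmap : forall X Y, hom X Y -> hom (fob X) (fob Y);
  fmap_id : forall X, fmap (idm X) = idm (fob X);
  fmap_comp : forall X Y Z (g : hom Y Z) (f : hom X Y),
    fmap (g \oc f) = fmap g \oc fmap f }.

Arguments fmap {C D} f {X Y} _ : rename.

Section FunctorComposition.
Variables (C D E : category) (G : functor D E) (F : functor C D).

Lemma fcomp_id X : fmap G (fmap F (idm X)) = idm (G (F X)).
Proof. by rewrite !fmap_id. Qed.

Lemma fcomp_comp X Y Z (g : hom Y Z) (f : hom X Y) :
  fmap G (fmap F (g \oc f)) = fmap G (fmap F g) \oc fmap G (fmap F f).
Proof. by rewrite !fmap_comp. Qed.

Definition fcomp : functor C E := Functor fcomp_id fcomp_comp.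

End FunctorComposition.

Record nat_trans (C D : category) (F G : functor C D) := NatTrans {
  ntc :> forall X, hom (F X) (G X);
  nt_natural : forall X Y (f : hom X Y),
    ntc Y \oc fmap F f = fmap G f \oc ntc X }.

Section FunctorCategory.
Variables C D : category.
Implicit Types F G H K : functor C D.

Lemma nat_trans_eq F G (s t : nat_trans F G) : (forall X, s X = t X) -> s = t.
Proof.
case: s t => [s Hs] [t Ht] /= /(@functional_extensionality_dep _ _ s t) st.
by case: t / st Ht => Ht; rewrite (Prop_irrelevance Hs Ht).
Qed.

Lemma nt_id_natural F X Y (f : hom X Y) :
  idm (F Y) \oc fmap F f = fmap F f \oc idm (F X).
Proof. by rewrite comp_idl comp_idr. Qed.

Definition nt_id F : nat_trans F F := NatTrans (@nt_id_natural F).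

Lemma nt_comp_natural F G H (t : nat_trans G H) (s : nat_trans F G) X Y
    (f : hom X Y) :
  (t Y \oc s Y) \oc fmap F f = fmap H f \oc (t X \oc s X).
Proof. by rewrite -compA nt_natural compA nt_natural compA. Qed.

Definition nt_comp F G H (t : nat_trans G H) (s : nat_trans F G) :=
  NatTrans (nt_comp_natural t s).

Lemma nt_comp_idl F G (s : nat_trans F G) : nt_comp (nt_id G) s = s.
Proof. by apply: nat_trans_eq => X; apply: comp_idl. Qed.

Lemma nt_comp_idr F G (s : nat_trans F G) : nt_comp s (nt_id F) = s.
Proof. by apply: nat_trans_eq => X; apply: comp_idr. Qed.

Lemma nt_compA F G H K (u : nat_trans H K) (t : nat_trans G H)
    (s : nat_trans F G) :
  nt_comp u (nt_comp t s) = nt_comp (nt_comp u t) s.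
Proof. by apply: nat_trans_eq => X; apply: compA. Qed.

Definition fun_cat : category := Category nt_comp_idl nt_comp_idr nt_compA.

End FunctorCategory.

Section FullSubcategory.
Variables (C : category) (P : C -> Prop).

Definition full_sub : category :=
  @Category {X : C | P X} (fun X Y => hom (sval X) (sval Y))
    (fun X => idm (sval X)) (fun X Y Z g f => g \oc f)
    (fun X Y f => comp_idl f) (fun X Y f => comp_idr f)
    (fun X Y Z T h g f => compA h g f).

Definition incl : functor full_sub C :=
  @Functor full_sub C (fun X => sval X) (fun X Y f => f)
    (fun X => erefl) (fun X Y Z g f => erefl).

End FullSubcategory.

Section PosetCategory.
Variables (d : Order.disp_t) (L : porderType d).
Local Open Scope order_scope.

Definition poset_cat : category :=
  @Category L (fun x y => x <= y) (fun x => lexx x)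
    (fun x y z (yz : y <= z) (xy : x <= y) => le_trans xy yz)
    (fun x y f => bool_irrelevance _ _) (fun x y f => bool_irrelevance _ _)
    (fun x y z t h g f => bool_irrelevance _ _).

End PosetCategory.

Section Morphisms.
Variable C : category.
Implicit Types X Y Z K Q T : C.

Definition is_iso X Y (f : hom X Y) :=
  exists g : hom Y X, g \oc f = idm X /\ f \oc g = idm Y.

Definition isomorphic X Y := exists f : hom X Y, is_iso f.

Definition monic X Y (f : hom X Y) :=
  forall T (g h : hom T X), f \oc g = f \oc h -> g = h.

Definition epic X Y (f : hom X Y) :=
  forall T (g h : hom Y T), g \oc f = h \oc f -> g = h.

Definition is_zero Z :=
  (forall X, exists! f : hom X Z, True) /\ (forall X, exists! f : hom Z X, True).

(* In an additive category these are exactly the zeros of the hom groups. *)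
Definition zero_mor X Y (f : hom X Y) :=
  exists Z (a : hom X Z) (b : hom Z Y), is_zero Z /\ f = b \oc a.

Definition is_ker X Y (f : hom X Y) K (k : hom K X) :=
  zero_mor (f \oc k) /\
  forall T (g : hom T X), zero_mor (f \oc g) -> exists! u : hom T K, k \oc u = g.

Definition is_coker X Y (f : hom X Y) Q (q : hom Y Q) :=
  zero_mor (q \oc f) /\
  forall T (g : hom Y T), zero_mor (g \oc f) -> exists! u : hom Q T, u \oc q = g.

Definition is_ses X Y Z (f : hom X Y) (g : hom Y Z) := is_ker g f /\ is_coker f g.

Definition has_kernels :=
  forall X Y (f : hom X Y), exists K (k : hom K X), is_ker f k.

Definition has_cokernels :=
  forall X Y (f : hom X Y), exists Q (q : hom Y Q), is_coker f q.

(* p : X -> coim is the coimage of f, i : im -> Y its image, and u the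
   canonical morphism coim -> im, which f = i \oc u \oc p characterizes. *)
Definition strict X Y (f : hom X Y) :=
  exists K (k : hom K X) coim (p : hom X coim)
         Q (q : hom Y Q) im (i : hom im Y) (u : hom coim im),
    [/\ is_ker f k /\ is_coker k p, is_coker f q /\ is_ker q i,
        f = i \oc u \oc p & is_iso u].

(* (g', f') is a pushout of (f, g). *)
Definition is_pushout X Y Z T (f : hom X Y) (g : hom X Z)
    (g' : hom Y T) (f' : hom Z T) :=
  g' \oc f = f' \oc g /\
  forall U (a : hom Y U) (b : hom Z U), a \oc f = b \oc g ->
    exists! u : hom T U, u \oc g' = a /\ u \oc f' = b.

(* (g', f') is a pullback of (f, g). *)
Definition is_pullback X Y Z T (f : hom Y X) (g : hom Z X)
    (g' : hom T Y) (f' : hom T Z) :=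
  f \oc g' = g \oc f' /\
  forall U (a : hom U Y) (b : hom U Z), f \oc a = g \oc b ->
    exists! u : hom U T, g' \oc u = a /\ f' \oc u = b.

Definition kernel_mor K X (k : hom K X) :=
  exists Y (f : hom X Y), is_ker f k.

Definition cokernel_mor Y Q (q : hom Y Q) :=
  exists X (f : hom X Y), is_coker f q.

Record preadditive := Preadditive {
  hadd : forall X Y, hom X Y -> hom X Y -> hom X Y;
  hzero : forall X Y, hom X Y;
  hopp : forall X Y, hom X Y -> hom X Y;
  haddA : forall X Y, associative (@hadd X Y);
  haddC : forall X Y, commutative (@hadd X Y);
  hadd0 : forall X Y, left_id (hzero X Y) (@hadd X Y);
  haddN : forall X Y, left_inverse (hzero X Y) (@hopp X Y) (@hadd X Y);
  hcompDl : forall X Y Z (g h : hom Y Z) (f : hom X Y),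
    hadd g h \oc f = hadd (g \oc f) (h \oc f);
  hcompDr : forall X Y Z (g : hom Y Z) (f h : hom X Y),
    g \oc hadd f h = hadd (g \oc f) (g \oc h) }.

(* The addition is uniquely determined when it exists, so that being additive
   is a property of the bare category. *)
Definition additive_category :=
  exists A : preadditive,
    (exists Z, is_zero Z) /\
    forall X Y, exists S (i1 : hom X S) (i2 : hom Y S)
                         (p1 : hom S X) (p2 : hom S Y),
      [/\ p1 \oc i1 = idm X, p2 \oc i2 = idm Y,
          p1 \oc i2 = hzero A Y X, p2 \oc i1 = hzero A X Y
        & hadd A (i1 \oc p1) (i2 \oc p2) = idm S].

Definition quasi_abelian :=
  [/\ additive_category, has_kernels, has_cokernels,
      (forall X Y Z T (f : hom X Y) (g : hom X Z) (g' : hom Y T) (f' : hom Z T),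
         is_pushout f g g' f' -> kernel_mor f -> kernel_mor f')
    & (forall X Y Z T (f : hom Y X) (g : hom Z X) (g' : hom T Y) (f' : hom T Z),
         is_pullback f g g' f' -> cokernel_mor f -> cokernel_mor f')].

Definition abelian :=
  [/\ additive_category, has_kernels, has_cokernels
    & forall X Y (f : hom X Y), strict f].

End Morphisms.

Section ExactFunctors.
Variables (C D : category) (F : functor C D).

Definition preserves_ses :=
  forall X Y Z (f : hom X Y) (g : hom Y Z),
    is_ses f g -> is_ses (fmap F f) (fmap F g).

Definition preserves_kernels :=
  forall X Y (f : hom X Y) K (k : hom K X),
    is_ker f k -> is_ker (fmap F f) (fmap F k).

Definition preserves_cokernels :=
  forall X Y (f : hom X Y) Q (q : hom Y Q),
    is_coker f q -> is_coker (fmap F f) (fmap F q).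

End ExactFunctors.

Section Colimits.
Variables (J C : category) (F : functor J C).

Definition is_cocone M (c : forall j, hom (F j) M) :=
  forall i j (a : hom i j), c j \oc fmap F a = c i.

Definition is_colimit M (c : forall j, hom (F j) M) :=
  is_cocone c /\
  forall N (d : forall j, hom (F j) N), is_cocone d ->
    exists! u : hom M N, forall j, u \oc c j = d j.

End Colimits.

(* A porderZmodType carries an order and an addition with no compatibility
   between them, hence the second condition. *)
Definition ordered_divisible_group (L : porderZmodType) :=
  [/\ total (<=%R : rel L),
      (forall x y z : L, x <= y -> x + z <= y + z)
    & forall (n : nat) (x : L), (0 < n)%N -> exists! y : L, y *+ n = x].

Record rank_function (A : category) := RankFunction {
  rk :> A -> nat;
  rk_iso : forall M N, isomorphic M N -> rk M = rk N;
  rk_ses : forall M N P (f : hom M N) (g : hom N P),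
    is_ses f g -> rk N = (rk M + rk P)%N;
  rk_neq0 : forall M, ~ is_zero M -> rk M <> 0%N }.

Record degree_function (A : category) (L : zmodType) := DegreeFunction {
  deg :> A -> L;
  deg_iso : forall M N, isomorphic M N -> deg M = deg N;
  deg_ses : forall M N P (f : hom M N) (g : hom N P),
    is_ses f g -> deg N = deg M + deg P }.

Section Slopes.
Variables (A : category) (L : porderZmodType).
Variables (r : rank_function A) (d : degree_function A L).

(* deg M / rk M, the unique y with y *+ rk M = deg M when M is nonzero and
   division is unique; a junk value when M is zero. *)
Definition slope (M : A) : L := xget 0 [set y | y *+ r M = d M]%classic.

Definition slope_function :=
  forall (M N : A) (f : hom M N),
    ~ is_zero M -> ~ is_zero N -> epic f -> monic f ->
    slope M <= slope N /\ (slope M = slope N <-> is_iso f).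

Definition semistable (M : A) :=
  ~ is_zero M /\
  forall (N : A) (i : hom N M), monic i -> ~ is_zero N -> slope N <= slope M.

Definition pure (l : L) (M : A) :=
  is_zero M \/ semistable M /\ slope M = l.

End Slopes.

Section Filtrations.
Variables (A : category) (L : porderZmodType).
Local Notation Fun := (fun_cat (poset_cat L) A).

(* s lists the breaks in increasing order; equalities between the W_{<= l} M
   are read as the transition maps being isomorphisms. *)
Definition finite_breaks (W : Fun) (M : A) (c : forall l : L, hom (W l) M) :=
  exists s : seq L,
    [/\ sorted <%R s, (s = [::] <-> is_zero M),
        (forall l, all (fun b => l < b) s -> is_zero (W l)),
        (forall i l (hl : s`_i <= l), (i.+1 < size s)%N -> l < s`_i.+1 ->
           is_iso (@fmap _ _ W s`_i l hl))
      & (forall l, s <> [::] -> last 0 s <= l -> is_iso (c l))].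

(* W is the functor l |-> W_{<= l} M of a finite ascending filtration (M, W). *)
Definition filtration (W : Fun) :=
  exists (M : A) (c : forall l : L, hom (W l) M),
    [/\ @is_colimit (poset_cat L) A W M c,
        (forall l, strict (c l) /\ monic (c l))
      & finite_breaks c].

Definition below (l : L) : category :=
  full_sub (fun x : poset_cat L => x < l : Prop).

Definition restrict_below (W : Fun) (l : L) : functor (below l) A :=
  fcomp W (@incl (poset_cat L) (fun x => x < l : Prop)).

(* V is W_{< l} M, the morphism u is the canonical one to W_{<= l} M, and G is
   its cokernel gr_l M. *)
Definition is_gr (W : Fun) (l : L) (G : A) :=
  exists (V : A) (c : forall j : below l, hom (restrict_below W l j) V)
         (u : hom V (W l)) (q : hom (W l) G),
    [/\ is_colimit c,
        (forall j : below l, u \oc c j = @fmap _ _ W _ l (ltW (svalP j)))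
      & is_coker u q].

Variables (r : rank_function A) (d : degree_function A L).

Definition mixed (W : Fun) :=
  filtration W /\ forall l : L, exists G : A, is_gr W l G /\ pure r d l G.

Definition mixed_cat : category := full_sub mixed.

Definition mixed_incl : functor mixed_cat Fun := incl mixed.

End Filtrations.

(* Main.v *)
(* The key point is that a morphism f : (M, W) -> (N, W') of mixed structures
   has a strict component at each level l, and that the levelwise kernels and
   cokernels are again mixed structures. This goes by induction on the number
   of breaks up to l. On the graded pieces, f is a morphism of semistable
   objects of the same slope, which is strict with semistable kernel and
   cokernel because its coimage has slope at least, and its image slope at most,
   the common slope. At a break b with preceding level l, the snake lemma
   relates the kernels and cokernels at the levels l and b to those of gr_b; its
   connecting morphism goes from Ker(gr_b f), semistable of slope b, to the
   cokernel at level l, an iterated extension of semistable objects of slopes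
   < b, and therefore vanishes. In a quasi-abelian category the diagram chases
   are done on generalized elements T -> X, lifted through strict epics after
   replacing T by a cover. *)
From HB Require Import structures.
From mathcomp Require Import all_boot all_order all_algebra.
From mathcomp Require Import boolp classical_sets.
Require Import Defs.

Set Implicit Arguments.
Unset Strict Implicit.
Unset Printing Implicit Defensive.

Import Order.TTheory GRing.Theory.
Local Open Scope ring_scope.

(** Source and target of a morphism break at different levels, and a kernel or cokernel may break
    less often. Finiteness also disposes of the colimits: W_{<m} is the value at the last point of s
    before m, or zero, even when the order is dense. Strictness alone does not survive the
    induction, because the snake lemma also needs a vanishing Hom group. The invariant at l pairs
    strictness with the vanishing of all morphisms from pure objects of slope above l to the
    cokernel at l. Once levelwise kernels and cokernels are mixed, both claims are formal: the
    comparison of coimage and image is invertible at each level, and the inclusion of a full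
    subcategory that contains the ambient kernels and cokernels preserves them. Dual halves are read
    off in the opposite category, again quasi-abelian. *)

(** * Zero morphisms and zero objects in a preadditive category *)

Section Preadditive.
Variables (C : category) (P : preadditive C).
Implicit Types X Y Z : C.

Lemma haddI X Y (f g : hom X Y) : hadd P f g = g -> f = hzero P X Y.
Proof.
move=> e; rewrite -[f](hadd0 P) haddC -(haddN P g).
by rewrite (haddC P (hopp P g)) haddA e.
Qed.

Lemma hcomp0l X Y Z (f : hom X Y) : hzero P Y Z \oc f = hzero P X Z.
Proof. by apply: (haddI (g := hzero P Y Z \oc f)); rewrite -hcompDl hadd0. Qed.

Lemma hcomp0r X Y Z (f : hom Y Z) : f \oc hzero P X Y = hzero P X Z.
Proof. by apply: (haddI (g := f \oc hzero P X Y)); rewrite -hcompDr hadd0. Qed.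

Lemma hom_to_zero X Z (f g : hom X Z) : is_zero Z -> f = g.
Proof. by case=> /(_ X) [h [_ hu]] _; rewrite -(hu f) // -(hu g). Qed.

Lemma hom_from_zero X Z (f g : hom Z X) : is_zero Z -> f = g.
Proof. by case=> _ /(_ X) [h [_ hu]]; rewrite -(hu f) // -(hu g). Qed.

Lemma zero_morE (z : exists Z : C, is_zero Z) X Y (f : hom X Y) :
  zero_mor f <-> f = hzero P X Y.
Proof.
split=> [[Z [a [b [zZ ->]]]]|->].
  by rewrite (hom_to_zero a (hzero P X Z) zZ) hcomp0r.
by case: z => Z zZ; exists Z, (hzero P _ _), (hzero P _ _); rewrite hcomp0r.
Qed.

Lemma is_zeroP Z : is_zero Z <-> idm Z = hzero P Z Z.
Proof.
split=> [zZ|e]; first exact: hom_to_zero.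
split=> X; exists (hzero P _ _); split=> // f _.
  by rewrite -[f]comp_idl e hcomp0l.
by rewrite -[f]comp_idr e hcomp0r.
Qed.

End Preadditive.

(** * Quasi-abelian categories *)

Record biproduct (C : category) (P : preadditive C) (X Y : C) := Biproduct {
  bsum :> C;
  bin1 : hom X bsum;
  bin2 : hom Y bsum;
  bpr1 : hom bsum X;
  bpr2 : hom bsum Y;
  bpr1_in1 : bpr1 \oc bin1 = idm X;
  bpr2_in2 : bpr2 \oc bin2 = idm Y;
  bpr1_in2 : bpr1 \oc bin2 = hzero P Y X;
  bpr2_in1 : bpr2 \oc bin1 = hzero P X Y;
  bsumE : hadd P (bin1 \oc bpr1) (bin2 \oc bpr2) = idm bsum }.

Arguments bin1 {C P X Y}. Arguments bin2 {C P X Y}.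
Arguments bpr1 {C P X Y}. Arguments bpr2 {C P X Y}.

(** Addition and biproducts are chosen as data, so that hom sets become [zmodType] instances and the
    opposite category is again a [qacat]; dual lemmas are then instances at [qop]. *)
Record qacat := QACat {
  qcat :> category;
  qadd : preadditive qcat;
  qzero : exists Z : qcat, is_zero Z;
  qbip : forall X Y, biproduct qadd X Y;
  qker : has_kernels qcat;
  qcoker : has_cokernels qcat;
  qpush : forall (X Y Z T : qcat) (f : hom X Y) (g : hom X Z)
    (g' : hom Y T) (f' : hom Z T),
    is_pushout f g g' f' -> kernel_mor f -> kernel_mor f';
  qpull : forall (X Y Z T : qcat) (f : hom Y X) (g : hom Z X)
    (g' : hom T Y) (f' : hom T Z),
    is_pullback f g g' f' -> cokernel_mor f -> cokernel_mor f' }.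

(** An equality of categories, so that rank, degree and slope data transport by substitution. *)
Lemma quasi_abelian_qacat (A : category) :
  quasi_abelian A -> exists C : qacat, A = qcat C.
Proof.
case=> [[P [z b]] hk hc hpo hpb].
have bip X Y : biproduct P X Y.
  case/cid: (b X Y) => S /cid[i1 /cid[i2 /cid[p1 /cid[p2 [? ? ? ? ?]]]]].
  exact: (@Biproduct _ P X Y S i1 i2 p1 p2).
by exists (@QACat A P z bip hk hc hpo hpb).
Qed.

(** * The opposite category *)

Section Opposite.
Variable C : category.

Definition op : category :=
  @Category C (fun X Y => @hom C Y X) (fun X => idm X)
    (fun X Y Z g f => comp f g) (fun X Y f => comp_idr f)
    (fun X Y f => comp_idl f)
    (fun X Y Z T h g f => esym (compA f g h)).

Lemma op_is_zero (Z : C) : @is_zero op Z <-> is_zero Z.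
Proof. by split; case. Qed.

Lemma op_zero_mor (X Y : C) (f : hom X Y) : @zero_mor op Y X f <-> zero_mor f.
Proof. by split=> -[Z [a [b [[? ?] ->]]]]; exists Z, b, a. Qed.

Lemma op_is_ker (X Y Q : C) (f : hom X Y) (q : hom Y Q) :
  @is_ker op Y X f Q q <-> is_coker f q.
Proof.
split=> -[/op_zero_mor z u]; split=> // T g /op_zero_mor; exact: u.
Qed.

Lemma op_is_coker (X Y K : C) (f : hom X Y) (k : hom K X) :
  @is_coker op Y X f K k <-> is_ker f k.
Proof.
split=> -[/op_zero_mor z u]; split=> // T g /op_zero_mor; exact: u.
Qed.

Variable P : preadditive C.

Definition op_preadditive : preadditive op :=
  @Preadditive op (fun X Y => @hadd C P Y X) (fun X Y => hzero P Y X)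
    (fun X Y => @hopp C P Y X) (fun X Y => @haddA C P Y X)
    (fun X Y => @haddC C P Y X) (fun X Y => @hadd0 C P Y X)
    (fun X Y => @haddN C P Y X)
    (fun X Y Z g h f => hcompDr P f g h) (fun X Y Z g f h => hcompDl P f h g).

Definition op_biproduct X Y (S : biproduct P X Y) :
  @biproduct op op_preadditive X Y :=
  @Biproduct op op_preadditive X Y (bsum S) (bpr1 S) (bpr2 S) (bin1 S) (bin2 S)
    (bpr1_in1 S) (bpr2_in2 S) (bpr2_in1 S) (bpr1_in2 S) (bsumE S).

End Opposite.

Section OppositeQA.
Variable C : qacat.

Lemma op_zero : exists Z : op C, is_zero Z.
Proof. by case: (qzero C) => Z /op_is_zero; exists Z. Qed.

Lemma op_has_kernels : has_kernels (op C).
Proof.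
by move=> X Y f; case: (@qcoker C Y X f) => Q [q /op_is_ker]; exists Q, q.
Qed.

Lemma op_has_cokernels : has_cokernels (op C).
Proof.
by move=> X Y f; case: (@qker C Y X f) => Q [q /op_is_coker]; exists Q, q.
Qed.

Lemma op_push (X Y Z T : op C) (f : hom X Y) (g : hom X Z)
    (g' : hom Y T) (f' : hom Z T) :
  is_pushout f g g' f' -> kernel_mor f -> kernel_mor f'.
Proof.
move=> po [W [h /op_is_ker hf]].
have : cokernel_mor (f' : @hom C T Z).
  by apply: (@qpull C _ _ _ _ f g g' f') => //; exists W, h.
by case=> V [k /op_is_ker]; exists V, k.
Qed.

Lemma op_pull (X Y Z T : op C) (f : hom Y X) (g : hom Z X)
    (g' : hom T Y) (f' : hom T Z) :
  is_pullback f g g' f' -> cokernel_mor f -> cokernel_mor f'.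
Proof.
move=> po [W [h /op_is_coker hf]].
have : kernel_mor (f' : @hom C Z T).
  by apply: (@qpush C _ _ _ _ f g g' f') => //; exists W, h.
by case=> V [k /op_is_coker]; exists V, k.
Qed.

Definition qop : qacat :=
  @QACat (op C) (op_preadditive (qadd C)) op_zero
    (fun X Y => op_biproduct (qbip X Y))
    op_has_kernels op_has_cokernels op_push op_pull.

End OppositeQA.

(** * Hom groups, kernels and strictness by equations *)

HB.instance Definition _ (C : qacat) (X Y : C) := gen_eqMixin (hom X Y).
HB.instance Definition _ (C : qacat) (X Y : C) := gen_choiceMixin (hom X Y).
HB.instance Definition _ (C : qacat) (X Y : C) :=
  GRing.isZmodule.Build (hom X Y) (@haddA C (qadd C) X Y)
    (@haddC C (qadd C) X Y) (@hadd0 C (qadd C) X Y) (@haddN C (qadd C) X Y).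

Section HomGroups.
Variable C : qacat.
Implicit Types X Y Z T : C.

Lemma compDl X Y Z (g h : hom Y Z) (f : hom X Y) :
  (g + h) \oc f = g \oc f + h \oc f.
Proof. exact: hcompDl. Qed.

Lemma compDr X Y Z (g : hom Y Z) (f h : hom X Y) :
  g \oc (f + h) = g \oc f + g \oc h.
Proof. exact: hcompDr. Qed.

Lemma comp0l X Y Z (f : hom X Y) : (0 : hom Y Z) \oc f = 0.
Proof. exact: hcomp0l. Qed.

Lemma comp0r X Y Z (f : hom Y Z) : f \oc (0 : hom X Y) = 0.
Proof. exact: hcomp0r. Qed.

Lemma compBl X Y Z (g h : hom Y Z) (f : hom X Y) :
  (g - h) \oc f = g \oc f - h \oc f.
Proof. by apply/eqP; rewrite eq_sym subr_eq -compDl subrK. Qed.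

Lemma compBr X Y Z (g : hom Y Z) (f h : hom X Y) :
  g \oc (f - h) = g \oc f - g \oc h.
Proof. by apply/eqP; rewrite eq_sym subr_eq -compDr subrK. Qed.

Lemma compNl X Y Z (g : hom Y Z) (f : hom X Y) : (- g) \oc f = - (g \oc f).
Proof. by rewrite -[- g]sub0r compBl comp0l sub0r. Qed.

Lemma compNr X Y Z (g : hom Y Z) (f : hom X Y) : g \oc (- f) = - (g \oc f).
Proof. by rewrite -[- f]sub0r compBr comp0r sub0r. Qed.

Lemma monicP X Y (f : hom X Y) :
  monic f <-> forall T (g : hom T X), f \oc g = 0 -> g = 0.
Proof.
split=> [m T g fg0|m T g h e]; first by apply: m; rewrite fg0 comp0r.
by apply/eqP; rewrite -subr_eq0; apply/eqP/m; rewrite compBr e subrr.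
Qed.

Lemma epicP X Y (f : hom X Y) :
  epic f <-> forall T (g : hom Y T), g \oc f = 0 -> g = 0.
Proof.
split=> [m T g fg0|m T g h e]; first by apply: m; rewrite fg0 comp0l.
by apply/eqP; rewrite -subr_eq0; apply/eqP/m; rewrite compBl e subrr.
Qed.

Lemma zeroP Z : is_zero Z <-> idm Z = 0.
Proof. exact: is_zeroP. Qed.

Lemma monic_comp X Y Z (g : hom Y Z) (f : hom X Y) :
  monic g -> monic f -> monic (g \oc f).
Proof. by move=> mg mf T a b; rewrite -!compA => /mg /mf. Qed.

Lemma monic_of_comp X Y Z (g : hom Y Z) (f : hom X Y) :
  monic (g \oc f) -> monic f.
Proof. by move=> m T a b e; apply: m; rewrite -!compA e. Qed.

(** Working form of [is_ker]: zero morphisms become equations with 0, and unique lifting splits into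
    monicity and existence. *)
Definition kr X Y K (f : hom X Y) (k : hom K X) :=
  [/\ f \oc k = 0, monic k
    & forall T (x : hom T X), f \oc x = 0 -> exists u, k \oc u = x].

Definition ck X Y Q (f : hom X Y) (q : hom Y Q) :=
  [/\ q \oc f = 0, epic q
    & forall T (x : hom Y T), x \oc f = 0 -> exists u, u \oc q = x].

Lemma krP X Y K (f : hom X Y) (k : hom K X) : is_ker f k <-> kr f k.
Proof.
have zE := zero_morE (qadd C) (qzero C).
split=> [[/zE fk u]|[fk m u]]; split=> //.
- move=> T g h e.
  have [|w [_ wu]] := u T (k \oc g).
    by apply/zE; rewrite compA fk hcomp0l.
  by rewrite -(wu g) // -(wu h).
- by move=> T x fx; have [|w [<-]] := u T x; [apply/zE|exists w].
- exact/zE.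
- move=> T x /zE fx; have [w kw] := u T x fx; exists w; split=> // v kv.
  by apply: m; rewrite kw kv.
Qed.

Definition ses X Y Z (f : hom X Y) (g : hom Y Z) := kr g f /\ ck f g.

(* Strict epics and (for [emb], dually) strict monics, in terms of generalized
   elements. *)
Definition cov X Q (e : hom X Q) :=
  epic e /\ forall Z (v : hom X Z),
    (forall S (t : hom S X), e \oc t = 0 -> v \oc t = 0) ->
    exists u, u \oc e = v.

Definition emb K X (e : hom K X) :=
  monic e /\ forall Z (v : hom Z X),
    (forall S (t : hom X S), t \oc e = 0 -> t \oc v = 0) ->
    exists u, e \oc u = v.

(** No kernel or cokernel is named, which makes the notion self-dual by exchanging [p] and [i]. *)
Definition qstrict X Y (f : hom X Y) :=
  exists I (p : hom X I) (i : hom I Y), [/\ f = i \oc p, cov p & emb i].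

End HomGroups.

Lemma ckP (C : qacat) (X Y Q : C) (f : hom X Y) (q : hom Y Q) :
  is_coker f q <-> ck f q.
Proof. by rewrite -op_is_ker; exact: (@krP (qop C)). Qed.

Lemma ses_op (C : qacat) (X Y Z : C) (f : hom X Y) (g : hom Y Z) :
  @ses (qop C) Z Y X g f <-> ses f g.
Proof. by split; case. Qed.

Lemma qstrict_op (C : qacat) (X Y : C) (f : hom X Y) :
  @qstrict (qop C) Y X f <-> qstrict f.
Proof. by split=> -[I [p [i [e cp ei]]]]; exists I, i, p. Qed.

(** * Strict epics as covers, and generalized elements *)

Section QuasiAbelian.
Variable C : qacat.
Implicit Types X Y Z T K Q I M N : C.

Lemma kr_exists X Y (f : hom X Y) : exists K (k : hom K X), kr f k.
Proof. by case: (qker f) => K [k /krP]; exists K, k. Qed.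

Lemma ck_exists X Y (f : hom X Y) : exists Q (q : hom Y Q), ck f q.
Proof. by case: (qcoker f) => Q [q /ckP]; exists Q, q. Qed.

Lemma ck_cov X Y Q (f : hom X Y) (q : hom Y Q) : ck f q -> cov q.
Proof. by case=> qf eq u; split=> // T v vq; apply: u; exact: vq. Qed.

Lemma cov_ck X Y K (f : hom X Y) (k : hom K X) : cov f -> kr f k -> ck k f.
Proof.
case=> ef u [fk mk uk]; split=> // T x xk; apply: u => S t /uk[w <-].
by rewrite compA xk comp0l.
Qed.

Lemma covP X Y (e : hom X Y) : cov e <-> cokernel_mor e.
Proof.
split=> [ce|[T [f /ckP/ck_cov]] //].
by have [K [k /(cov_ck ce)/ckP]] := kr_exists e; exists K, k.
Qed.

Lemma cov_epic X Y (e : hom X Y) : cov e -> epic e.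
Proof. by case. Qed.

Lemma cov_ses X Y K (f : hom X Y) (k : hom K X) : cov f -> kr f k -> ses k f.
Proof. by move=> cf kf; split=> //; apply: cov_ck. Qed.

Lemma ses_cov X Y K (f : hom X Y) (k : hom K X) : ses k f -> cov f.
Proof. by case=> _ /ck_cov. Qed.

Lemma is_iso_cov X Y (f : hom X Y) : is_iso f -> cov f.
Proof.
case=> g [gf fg]; split=> [T a b e|T v _].
  by rewrite -[a]comp_idr -[b]comp_idr -fg !compA e.
by exists (v \oc g); rewrite -compA gf comp_idr.
Qed.

Lemma cov_monic_iso X Y (e : hom X Y) : cov e -> monic e -> is_iso e.
Proof.
case=> ee u m; case: (u X (idm X)) => [S t /((monicP e).1 m) ->|v ve].
  by rewrite comp0r.
by exists v; split=> //; apply: ee; rewrite -compA ve comp_idl comp_idr.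
Qed.

Lemma pullback_exists X Y Z (f : hom Y X) (g : hom Z X) :
  exists T (g' : hom T Y) (f' : hom T Z), is_pullback f g g' f'.
Proof.
pose S := qbip Y Z.
have [T [k [dk mk uk]]] := kr_exists (f \oc bpr1 S - g \oc bpr2 S).
exists T, (bpr1 S \oc k), (bpr2 S \oc k).
have e : f \oc (bpr1 S \oc k) = g \oc (bpr2 S \oc k).
  by apply/eqP; rewrite -subr_eq0 !compA -compBl dk.
split=> // U a b fagb.
have p1 : bpr1 S \oc (bin1 S \oc a + bin2 S \oc b) = a.
  by rewrite compDr !compA bpr1_in1 bpr1_in2 comp_idl hcomp0l addr0.
have p2 : bpr2 S \oc (bin1 S \oc a + bin2 S \oc b) = b.
  by rewrite compDr !compA bpr2_in2 bpr2_in1 comp_idl hcomp0l add0r.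
have [|u ku] := uk _ (bin1 S \oc a + bin2 S \oc b).
  by rewrite compBl -!compA p1 p2 fagb subrr.
exists u; split; first by rewrite -!compA ku.
move=> v [v1 v2]; apply: mk; rewrite ku.
rewrite -[k \oc v]comp_idl -(bsumE S) hcompDl -!compA.
by rewrite (compA (bpr1 S)) (compA (bpr2 S)) v1 v2.
Qed.

Lemma cov_pullback X Y Z T (f : hom Y X) (g : hom Z X) (g' : hom T Y)
    (f' : hom T Z) :
  is_pullback f g g' f' -> cov f -> cov f'.
Proof. by move=> /qpull pb /covP/pb/covP. Qed.

(** Stability of cokernels under pullback, in the form that the chases use. *)
Lemma cov_lift X Y T (e : hom X Y) (y : hom T Y) : cov e ->
  exists T' (e' : hom T' T) (x : hom T' X), cov e' /\ e \oc x = y \oc e'.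
Proof.
move=> ce; have [T' [x [e' pb]]] := pullback_exists e y.
by exists T', e', x; split; [exact: cov_pullback pb ce|case: pb].
Qed.

(** A [t] vanishing wherever [g \oc f] does factors through [f] as [v \oc f]. For [v] to factor
    through [g], an element killed by [g] is lifted along [f] after a cover, and [t] vanishes on the
    lift. *)
Lemma cov_comp X Y Z (g : hom Y Z) (f : hom X Y) :
  cov g -> cov f -> cov (g \oc f).
Proof.
move=> [eg ug] cf; have [ef uf] := cf; split=> [T a b|T t tk].
  by rewrite !compA => /ef/eg.
have [v vf] : exists v, v \oc f = t.
  by apply: uf => S x fx; apply: tk; rewrite -compA fx comp0r.
have [w wg] : exists w, w \oc g = v.
  apply: ug => S y gy; have [S' [e [x [ce fx]]]] := cov_lift y cf.
  apply: (cov_epic ce); rewrite comp0l -compA -fx compA vf; apply: tk.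
  by rewrite -compA fx compA gy comp0l.
by exists w; rewrite compA wg.
Qed.

Lemma cov_of_comp X Y Z (g : hom Y Z) (f : hom X Y) : cov (g \oc f) -> cov g.
Proof.
move=> c; have [egf u] := c; split=> [T a b e|T t tk].
  by apply: egf; rewrite !compA e.
have [v vgf] : exists v, v \oc (g \oc f) = t \oc f.
  by apply: u => S x gfx; rewrite -compA; apply: tk; rewrite compA.
(* The elements [e] and [f \oc x] of Y agree under [g], so [t] takes the same value on them; as [e]
   is epic, [v \oc g] equals [t]. *)
exists v; have [S [e [x [ce gfx]]]] := cov_lift g c.
apply: (cov_epic ce); have : g \oc (e - f \oc x) = 0.
  by rewrite compBr compA gfx subrr.
move/tk; rewrite compBr compA -vgf -!compA (compA g) gfx => /eqP.
by rewrite subr_eq0 => /eqP.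
Qed.

(** An element of the coimage killed by [i] lifts to M after a cover; the lift is killed by [f], so
    it comes from K and dies in I. *)
Lemma coimage_monic M N K I (f : hom M N) (k : hom K M) (p : hom M I)
    (i : hom I N) : kr f k -> ck k p -> f = i \oc p -> monic i.
Proof.
move=> [fk mk uk] ckp fip; apply/monicP => T x ix.
have [pk ep up] := ckp; have [T' [e [y [ce py]]]] := cov_lift x (ck_cov ckp).
have /uk[z kz] : f \oc y = 0 by rewrite fip -compA py compA ix comp0l.
by apply: (cov_epic ce); rewrite comp0l -py -kz compA pk comp0l.
Qed.

Lemma coimage M N (f : hom M N) :
  exists K (k : hom K M) I (p : hom M I) (i : hom I N),
    [/\ kr f k, ses k p, f = i \oc p & monic i].
Proof.
have [K [k krk]] := kr_exists f; have [I [p ckp]] := ck_exists k.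
have [fk mk uk] := krk; have [pk ep up] := ckp.
have [i ip] := up _ f fk; have mi := coimage_monic krk ckp (esym ip).
exists K, k, I, p, i; split=> //; split=> //; split=> // T x px.
by apply: uk; rewrite -ip -compA px comp0r.
Qed.

(** Whatever [e] kills, [v] kills too because [a] is monic; hence [v] descends along the strict epic
    [e]. *)
Lemma descend X Y T T' (a : hom X Y) (z : hom T Y) (e : hom T' T)
    (v : hom T' X) :
  monic a -> cov e -> z \oc e = a \oc v -> exists u, a \oc u = z.
Proof.
move=> ma [ee ue] zv; have [S t et|u uv] := ue _ v.
  by apply: (monicP a).1 => //; rewrite compA -zv -compA et comp0r.
by exists u; apply: ee; rewrite -compA uv.
Qed.

End QuasiAbelian.

(** * Strict monics by duality, and morphisms of extensions *)

Section Duals.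
Variable C : qacat.
Implicit Types X Y Z T K Q I M N : C.

Lemma emb_comp X Y Z (g : hom Y Z) (f : hom X Y) :
  emb g -> emb f -> emb (g \oc f).
Proof. by move=> eg ef; exact: (@cov_comp (qop C) _ _ _ f g). Qed.

Lemma emb_of_comp X Y Z (g : hom Y Z) (f : hom X Y) : emb (g \oc f) -> emb f.
Proof. exact: (@cov_of_comp (qop C) _ _ _ f g). Qed.

Lemma embP X Y (e : hom X Y) : emb e <-> kernel_mor e.
Proof.
split=> [/(@covP (qop C))[Z [f /op_is_coker]]|[Z [f /op_is_coker h]]].
  by exists Z, f.
by apply/(@covP (qop C)); exists Z, f.
Qed.

Lemma is_iso_emb X Y (f : hom X Y) : is_iso f -> emb f.
Proof. by case=> g [gf fg]; apply: (@is_iso_cov (qop C)); exists g. Qed.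

Lemma ses_emb X Y K (f : hom X Y) (k : hom K X) : ses k f -> emb k.
Proof. by move=> /ses_op/(@ses_cov (qop C)). Qed.

Lemma emb_ses X Y Q (f : hom X Y) (q : hom Y Q) : emb f -> ck f q -> ses f q.
Proof. by move=> ef cq; apply/ses_op/(@cov_ses (qop C)). Qed.

Lemma image M N (f : hom M N) :
  exists Q (q : hom N Q) I (i : hom I N) (p : hom M I),
    [/\ ck f q, ses i q, f = i \oc p & epic p].
Proof.
have [Q [q [I [i [p [? /ses_op ? ? ?]]]]]] := @coimage (qop C) N M f.
by exists Q, q, I, i, p.
Qed.

Lemma is_iso_monic X Y (f : hom X Y) : is_iso f -> monic f.
Proof. by move=> /is_iso_emb[]. Qed.

(** For strict [f], an element killed by the cokernel comes from M after a cover. In [snake_ker],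
    strictness of [f'] enters through this. *)
Lemma qstrict_exact M N Q T (f : hom M N) (q : hom N Q) (y : hom T N) :
  qstrict f -> ck f q -> q \oc y = 0 ->
  exists T' (e : hom T' T) (x : hom T' M), cov e /\ f \oc x = y \oc e.
Proof.
move=> [I [p [i [-> cp [mi ui]]]]] [qf eq uq] qy.
have [S t ti|u iu] := ui _ y.
  have [|w <-] := uq _ t; first by rewrite compA ti comp0l.
  by rewrite -compA qy comp0r.
have [T' [e [x [ce px]]]] := cov_lift u cp.
by exists T', e, x; split=> //; rewrite -compA px compA iu.
Qed.

Section ExtensionRows.
Variables (M' M M'' N' N N'' : C).
Variables (i : hom M' M) (p : hom M M'') (j : hom N' N) (q : hom N N'').
Variables (f' : hom M' N') (f : hom M N) (f'' : hom M'' N'').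
Hypotheses (sM : ses i p) (sN : ses j q).
Hypotheses (fi : f \oc i = j \oc f') (qf : q \oc f = f'' \oc p).

Lemma ext_cov : cov f' -> cov f'' -> cov f.
Proof.
move=> cf' cf''; have cp := ses_cov sM; have [[qj mj uj] _] := sN.
have [T [e [x'' [ce fx'']]]] := cov_lift q cf''.
have [T1 [e1 [x [ce1 px]]]] := cov_lift x'' cp.
have /uj[n jn] : q \oc (e \oc e1 - f \oc x) = 0.
  by rewrite compBr !compA qf -fx'' -!compA px subrr.
have [T2 [e2 [x' [ce2 fx']]]] := cov_lift n cf'.
(* The lift [x] is corrected by an element of M' so that its image under [f] is the composite of
   covers [e \oc e1 \oc e2]; this forces [f] to be a cover. *)
apply: (@cov_of_comp _ _ _ _ _ (x \oc e2 + i \oc x')).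
have -> : f \oc (x \oc e2 + i \oc x') = e \oc e1 \oc e2.
  rewrite compDr !compA fi -!compA fx' (compA j) jn compBl -!compA.
  by rewrite addrC subrK.
by do 2?apply: cov_comp.
Qed.

End ExtensionRows.
End Duals.

Section ExtensionEmb.
Variable C : qacat.
Variables (M' M M'' N' N N'' : C).
Variables (i : hom M' M) (p : hom M M'') (j : hom N' N) (q : hom N N'').
Variables (f' : hom M' N') (f : hom M N) (f'' : hom M'' N'').

Lemma ext_emb : ses i p -> ses j q -> f \oc i = j \oc f' ->
  q \oc f = f'' \oc p -> emb f' -> emb f'' -> emb f.
Proof.
move=> /ses_op sM /ses_op sN fi qf.
by move=> ef' ef''; apply: (@ext_cov (qop C) _ _ _ _ _ _ q j p i f'' f f').
Qed.

End ExtensionEmb.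

(** * The snake lemma *)

Section Snake.
Variable C : qacat.
Variables (M' M M'' N' N N'' : C).
Variables (i : hom M' M) (p : hom M M'') (j : hom N' N) (q : hom N N'').
Variables (f' : hom M' N') (f : hom M N) (f'' : hom M'' N'').
Hypotheses (sM : ses i p) (sN : ses j q).
Hypotheses (fi : f \oc i = j \oc f') (qf : q \oc f = f'' \oc p).

Variables (K' K K'' C' : C) (k' : hom K' M') (k : hom K M) (k'' : hom K'' M'').
Variables (c' : hom N' C') (a : hom K' K) (b : hom K K'').
Hypotheses (kk' : kr f' k') (kk : kr f k) (kk'' : kr f'' k'').
Hypotheses (ka : k \oc a = i \oc k') (kb : k'' \oc b = p \oc k).

(* The vanishing of [Hom(K'', C')] kills the connecting morphism of the snake
   lemma, here [delta]. *)
Lemma snake_ker : qstrict f' -> ck f' c' -> (forall g : hom K'' C', g = 0) ->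
  ses a b.
Proof.
move=> sf' cc' hom0.
have [fk' mk' uk'] := kk'; have [fk mk uk] := kk; have [fk'' mk'' uk''] := kk''.
have [[pi mi ui] _] := sM; have [[qj mj uj] _] := sN; have cp := ses_cov sM.
have [cf' _ _] := cc'.
apply: cov_ses.
  have [T [e [y [ce py]]]] := cov_lift k'' cp.
  have /uj[n jn] : q \oc (f \oc y) = 0.
    by rewrite compA qf -compA py compA fk'' comp0l.
  (* Where [e] kills t, the element [y \oc t] comes from M', so [n \oc t] lies in the image of [f']
     and [c'] kills it: [c' \oc n] descends along [e]. *)
  have [delta cn] : exists delta, delta \oc e = c' \oc n.
    case: ce => _; apply=> S t et.
    have /ui[m im] : p \oc (y \oc t) = 0.
      by rewrite compA py -compA et comp0r.
    have nt : n \oc t = f' \oc m.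
      by apply: mj; rewrite !compA jn -fi -!compA im.
    by rewrite -compA nt compA cf' comp0l.
  rewrite (hom0 delta) comp0l in cn.
  (* As [delta] vanishes, [n] comes from some [m] in M' after a cover; subtracting [i \oc m] moves
     the lift [y] into the kernel of [f] without changing its image under [p]. *)
  have [T' [e' [m [ce' fm]]]] := qstrict_exact sf' cc' (esym cn).
  have /uk[x kx] : f \oc (y \oc e' - i \oc m) = 0.
    by rewrite compBr !compA -jn fi -!compA fm subrr.
  apply: (@cov_of_comp _ _ _ _ _ x).
  suff -> : b \oc x = e \oc e' by apply: cov_comp.
  apply: mk''; rewrite compA kb -compA kx compBr !compA pi comp0l subr0.
  by rewrite py.
split.
- by apply: mk''; rewrite compA kb -compA ka compA pi comp0l comp0r.
- by apply: (@monic_of_comp _ _ _ _ k); rewrite ka; apply: monic_comp.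
move=> T z bz.
have /ui[x ix] : p \oc (k \oc z) = 0 by rewrite compA -kb -compA bz comp0r.
have /uk'[w kw] : f' \oc x = 0.
  by apply: mj; rewrite compA -fi -compA ix compA fk comp0l comp0r.
by exists w; apply: mk; rewrite compA ka -compA kw.
Qed.

(** The coimage of [f] turns out to be an extension of I'' by I', both strictly embedded in the
    outer terms of the lower row, so [ext_emb] embeds it strictly in N. *)
Lemma snake_strict : qstrict f' -> qstrict f'' -> ses a b -> qstrict f.
Proof.
move=> [I' [e' [m' [f'E ce' em']]]] [I'' [e'' [m'' [f''E ce'' em'']]]].
move=> /ses_cov cb.
have [[pi mi ui] _] := sM; have [[qj mj uj] _] := sN; have cp := ses_cov sM.
have [fk' mk' uk'] := kk'; have [fk mk uk] := kk; have [fk'' mk'' uk''] := kk''.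
have [mm' _] := em'; have [mm'' _] := em''.
have [L [l [I [pf [jf [krl sl fE mjf]]]]]] := coimage f.
have cpf := ses_cov sl; have [[pfl _ upf] _] := sl.
have pfk : pf \oc k = 0.
  by apply: mjf; rewrite compA -fE fk comp0r.
have [al alE] : exists al, al \oc e' = pf \oc i.
  case: ce' => _; apply=> S t et; apply: mjf.
  by rewrite compA compA -fE fi f'E -!compA et !comp0r.
have [be beE] : exists be, be \oc pf = e'' \oc p.
  case: cpf => _; apply=> S t et; apply: mm''.
  by rewrite !compA -f''E -qf fE -!compA et !comp0r.
have jal : jf \oc al = j \oc m'.
  by apply: (cov_epic ce'); rewrite -!compA alE compA -fE fi f'E.
have qjf : q \oc jf = m'' \oc be.
  by apply: (cov_epic cpf); rewrite -!compA beE -fE qf f''E compA.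
have mal : monic al.
  by apply: (@monic_of_comp _ _ _ _ jf); rewrite jal; apply: monic_comp.
exists I, pf, jf; split=> //; apply: (ext_emb _ sN jal qjf em' em'').
apply: cov_ses.
  by apply: (@cov_of_comp _ _ _ _ _ pf); rewrite beE; apply: cov_comp.
split=> //.
  apply: (cov_epic ce'); rewrite -compA alE compA beE -compA pi.
  by rewrite comp0r comp0l.
(* Exactness in the middle uses that K covers K'': [p \oc x] comes from K'', hence from some w in K
   after a cover, and [x - k w] then comes from M' while [pf] ignores [k w]. *)
move=> T z bz; have [T1 [e1 [x [ce1 px]]]] := cov_lift z cpf.
have /uk''[y ky] : f'' \oc (p \oc x) = 0.
  rewrite f''E -compA (compA e'') -beE -compA px (compA be) bz.
  by rewrite comp0l comp0r.
have [T2 [e2 [w [ce2 bw]]]] := cov_lift y cb.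
have /ui[m im] : p \oc (x \oc e2 - k \oc w) = 0.
  by rewrite compBr !compA -kb -ky -!compA bw subrr.
apply: (descend mal (cov_comp ce1 ce2) (v := e' \oc m)).
rewrite compA -px (compA al) alE -!compA im compBr !compA pfk comp0l subr0.
by [].
Qed.

End Snake.

Section SnakeCoker.
Variable C : qacat.
Variables (M' M M'' N' N N'' : C).
Variables (i : hom M' M) (p : hom M M'') (j : hom N' N) (q : hom N N'').
Variables (f' : hom M' N') (f : hom M N) (f'' : hom M'' N'').
Variables (C' C0 C'' K'' : C) (c' : hom N' C') (c : hom N C0).
Variables (c'' : hom N'' C'').
Variables (k'' : hom K'' M'') (a : hom C' C0) (b : hom C0 C'').

(** Duality exchanges K'' with C', so the vanishing of Hom(K'', C') is self-dual, whereas strictness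
    is now asked of [f''] instead of [f']. *)
Lemma snake_coker : ses i p -> ses j q ->
  f \oc i = j \oc f' -> q \oc f = f'' \oc p ->
  ck f' c' -> ck f c -> ck f'' c'' ->
  a \oc c' = c \oc j -> b \oc c = c'' \oc q ->
  qstrict f'' -> kr f'' k'' -> (forall g : hom K'' C', g = 0) -> ses a b.
Proof.
move=> /ses_op sM /ses_op sN fi qf k1 k2 k3 ac bc /qstrict_op s c4 h0.
apply/ses_op.
exact: (@snake_ker (qop C) _ _ _ _ _ _ q j p i f'' f f' sN sM qf fi
  _ _ _ _ c'' c c' k'' b a).
Qed.

End SnakeCoker.

(** * Agreement with strictness as defined by coimage and image *)

Section Strictness.
Variable C : qacat.
Implicit Types X Y Z T K Q I M N : C.

Lemma is_iso_comp X Y Z (g : hom Y Z) (f : hom X Y) :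
  is_iso g -> is_iso f -> is_iso (g \oc f).
Proof.
move=> [g' [g'g gg']] [f' [f'f ff']]; exists (f' \oc g'); split.
  by rewrite compA -(compA f') g'g comp_idr.
by rewrite compA -(compA g) ff' comp_idr.
Qed.

Lemma is_iso_of_comp X Y Z (g : hom Y Z) (f : hom X Y) (h : hom X Z) :
  g \oc f = h -> is_iso h -> is_iso f -> is_iso g.
Proof.
move=> gf [h' [h'h hh']] [f' [f'f ff']]; exists (f \oc h'); split.
  have e : f \oc h' \oc g \oc f = f by rewrite -!compA gf h'h comp_idr.
  by rewrite -[LHS]comp_idr -ff' compA e.
by rewrite compA gf hh'.
Qed.

Lemma kr_unique X Y K K' (f : hom X Y) (k : hom K X) (k' : hom K' X) :
  kr f k -> kr f k' -> exists u, k \oc u = k' /\ is_iso u.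
Proof.
move=> [fk mk uk] [fk' mk' uk'].
have [u ku] := uk _ _ fk'; have [v kv] := uk' _ _ fk.
exists u; split=> //; exists v; split.
  by apply: mk'; rewrite compA kv ku comp_idr.
by apply: mk; rewrite compA ku kv comp_idr.
Qed.

(** The middle object of the given factorization is both a coimage and an image of [f]; [u] is the
    composite of the two resulting isomorphisms. *)
Lemma qstrict_comparison X Y K I Q J (f : hom X Y) (k : hom K X) (p : hom X I)
    (q : hom Y Q) (i : hom J Y) (u : hom I J) :
  qstrict f -> kr f k -> ck k p -> ck f q -> kr q i -> f = i \oc u \oc p ->
  is_iso u.
Proof.
move=> [I0 [p0 [i0 [fE [ep0 up0] [mi0 ui0]]]]] [fk mk uk] [pk ep up].
move=> [qf eq uq] [qi mi ui] fE'.
have [v vp] : exists v, v \oc p = p0.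
  by apply: up; apply: mi0; rewrite compA -fE fk comp0r.
have [w wp0] : exists w, w \oc p0 = p.
  apply: up0 => S t p0t; have [|s <-] := uk _ t.
    by rewrite fE -compA p0t comp0r.
  by rewrite compA pk comp0l.
have [v' iv'] : exists v', i \oc v' = i0.
  by apply: ui; apply: ep0; rewrite -compA -fE qf comp0l.
have [w' iw'] : exists w', i0 \oc w' = i.
  apply: ui0 => S t ti0; have [|s <-] := uq _ t.
    by rewrite fE compA ti0 comp0l.
  by rewrite -compA qi comp0r.
have -> : u = v' \oc v.
  by apply: mi; apply: ep; rewrite -fE' compA iv' -compA vp.
apply: is_iso_comp.
  exists w'; split; first by apply: mi0; rewrite compA iw' iv' comp_idr.
  by apply: mi; rewrite compA iv' iw' comp_idr.
exists w; split; last by apply: ep0; rewrite -compA wp0 vp comp_idl.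
by apply: ep; rewrite -compA vp wp0 comp_idl.
Qed.

Lemma qstrict_strict X Y (f : hom X Y) : qstrict f -> strict f.
Proof.
move=> sf; have [K [k krk]] := kr_exists f; have [I [p ckp]] := ck_exists k.
have [Q [q ckq]] := ck_exists f; have [J [i kri]] := kr_exists q.
have [fk _ _] := krk; have [qf _ _] := ckq.
have [_ ep up] := ckp; have [_ mi ui] := kri.
have [g ig] := ui _ _ qf.
have [|u ug] := up _ g; first by apply: mi; rewrite compA ig fk comp0r.
have fE : f = i \oc u \oc p by rewrite -compA ug.
exists K, k, I, p, Q, q, J, i, u; split=> //.
- by split; [apply/krP | apply/ckP].
- by split; [apply/ckP | apply/krP].
- exact: qstrict_comparison sf krk ckp ckq kri fE.
Qed.

Lemma idm_iso X : is_iso (idm X).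
Proof. by exists (idm X); rewrite comp_idl. Qed.

Lemma emb_strict X Y (f : hom X Y) : emb f -> strict f /\ monic f.
Proof.
move=> ef; split; last by case: ef.
apply: qstrict_strict; exists X, (idm X), f; split=> //.
  by rewrite comp_idr.
exact/is_iso_cov/idm_iso.
Qed.

(** For monic [f] the coimage projection is both a cokernel and monic, hence invertible, which
    leaves the kernel [i] up to isomorphism. *)
Lemma strict_monic_emb X Y (f : hom X Y) : strict f -> monic f -> emb f.
Proof.
move=> [K [k [I [p [Q [q [J [i [u [kp qi fE iu]]]]]]]]]] mf.
move: kp qi => [/krP krk /ckP ckp] [_ /krP kri]; have [fk _ _] := krk.
rewrite fE -compA; apply: emb_comp; first by apply/embP; exists Q, q; apply/krP.
apply: emb_comp; first exact: is_iso_emb.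
apply/is_iso_emb/(cov_monic_iso (ck_cov ckp)).
by rewrite fE in mf; apply: monic_of_comp mf.
Qed.

Lemma monic_zero X Y (f : hom X Y) : monic f -> is_zero Y -> is_zero X.
Proof.
move=> /monicP mf zY; apply/zeroP; apply: mf.
exact: hom_to_zero.
Qed.

Lemma epic_zero X Y (f : hom X Y) : epic f -> is_zero X -> is_zero Y.
Proof.
move=> /epicP mf zY; apply/zeroP; apply: mf.
exact: hom_from_zero.
Qed.

Lemma is_zero_iso X Y (f : hom X Y) : is_zero X -> is_zero Y -> is_iso f.
Proof.
by move=> zX zY; exists 0; split; [exact: hom_to_zero | exact: hom_to_zero].
Qed.

Lemma biproduct_ses X Y (S : biproduct (qadd C) X Y) :
  ses (bin1 S) (bpr2 S).
Proof.
have idE T (x : hom T S) :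
    x = bin1 S \oc (bpr1 S \oc x) + bin2 S \oc (bpr2 S \oc x).
  by rewrite -[LHS]comp_idl -(bsumE S) hcompDl !compA.
apply: cov_ses; last split.
- apply: (@cov_of_comp _ _ _ _ _ (bin2 S)); rewrite bpr2_in2.
  exact/is_iso_cov/idm_iso.
- exact: bpr2_in1.
- apply: (@monic_of_comp _ _ _ _ (bpr1 S)); rewrite bpr1_in1.
  exact/is_iso_monic/idm_iso.
- move=> T x px; exists (bpr1 S \oc x).
  by rewrite [RHS]idE px comp0r addr0.
Qed.

End Strictness.

(** * Slopes *)

Section OrderedGroup.
Variables (L : porderZmodType) (hL : ordered_divisible_group L).
Implicit Types x y z : L.

Lemma ogtot x y : (x <= y) \/ (y < x).
Proof.
have [/(_ x y) /orP[->|yx] _ _] := hL; first by left.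
by case: (eqVneq y x) => [->|n]; [left | right; rewrite lt_neqAle n].
Qed.

Lemma ogD2r z x y : x + z <= y + z <-> x <= y.
Proof.
have [_ h _] := hL; split=> [/(h _ _ (- z))|]; last exact: h.
by rewrite !addrK.
Qed.

Lemma ogD x y z t : x <= y -> z <= t -> x + z <= y + t.
Proof.
move=> xy zt; apply: (@le_trans _ _ (y + z)); first exact/ogD2r.
by rewrite ![y + _]addrC; apply/ogD2r.
Qed.

Lemma ogMn n x y : x <= y -> x *+ n <= y *+ n.
Proof. by move=> xy; elim: n => // n IH; rewrite !mulrS; apply: ogD. Qed.

Lemma ogMn_inj n x y : (0 < n)%N -> x *+ n = y *+ n -> x = y.
Proof.
have [_ _ h] := hL => n0 e; have [z [_ u]] := h n (x *+ n) n0.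
by rewrite -(u x) // -(u y).
Qed.

Lemma ogMn_le n x y : (0 < n)%N -> (x *+ n <= y *+ n) = (x <= y).
Proof.
move=> n0; apply/idP/idP => [xy|]; last exact: ogMn.
case: (ogtot x y) => // yx; have e : x *+ n = y *+ n.
  by apply: le_anti; rewrite xy ogMn // ltW.
by rewrite (ogMn_inj n0 e) ltxx in yx.
Qed.

End OrderedGroup.

(** * Pure objects and their morphisms *)

Section Slopes.
Variables (L : porderZmodType) (hL : ordered_divisible_group L) (C : qacat).
Variables (r : rank_function C) (d : degree_function C L).
Hypothesis hmu : slope_function r d.
Implicit Types X Y Z T K Q I M N : C.

Lemma rkD M N P (f : hom M N) (g : hom N P) :
  ses f g -> r N = (r M + r P)%N.
Proof. by case=> /krP kg /ckP cf; exact: (rk_ses r (conj kg cf)). Qed.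

Lemma degD M N P (f : hom M N) (g : hom N P) : ses f g -> d N = d M + d P.
Proof. by case=> /krP kg /ckP cf; exact: (deg_ses d (conj kg cf)). Qed.

Lemma zero_ses Z (f : hom Z Z) : is_zero Z -> ses f f.
Proof.
move=> zZ; split; split.
- exact: hom_to_zero.
- by move=> *; exact: hom_to_zero.
- by move=> T x _; exists x; exact: hom_to_zero.
- exact: hom_to_zero.
- by move=> *; exact: hom_from_zero.
- by move=> T x _; exists x; exact: hom_from_zero.
Qed.

Lemma rk0 Z : is_zero Z -> r Z = 0%N.
Proof.
move=> /(zero_ses (idm Z))/rkD/eqP.
by rewrite -[X in X == _]addn0 eqn_add2l => /eqP.
Qed.

Lemma deg0 Z : is_zero Z -> d Z = 0.
Proof.
move=> /(zero_ses (idm Z))/degD/eqP.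
by rewrite -subr_eq0 opprD addrA subrr sub0r oppr_eq0 => /eqP.
Qed.

Lemma rk_gt0 M : ~ is_zero M -> (0 < r M)%N.
Proof. by move/(@rk_neq0 _ r M); case: (r M). Qed.

Lemma slopeE M : ~ is_zero M -> slope r d M *+ r M = d M.
Proof.
move=> /rk_gt0 r0; have [_ _ h] := hL; have [y [e _]] := h _ (d M) r0.
by rewrite /slope; case: xgetP => [_ -> //|/(_ y)[]].
Qed.

Lemma slope_le M l : ~ is_zero M -> (slope r d M <= l) = (d M <= l *+ r M).
Proof. by move=> nz; rewrite -(ogMn_le hL _ _ (rk_gt0 nz)) slopeE. Qed.

Lemma slope_ge M l : ~ is_zero M -> (l <= slope r d M) = (l *+ r M <= d M).
Proof. by move=> nz; rewrite -(ogMn_le hL _ _ (rk_gt0 nz)) slopeE. Qed.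

(* [pure] with denominators cleared, so that zero objects need no separate
   treatment. *)
Definition lpure l M :=
  d M = l *+ r M /\ forall N (i : hom N M), monic i -> d N <= l *+ r N.

Lemma lpureP l M : pure r d l M <-> lpure l M.
Proof.
split=> [[zM|[[nz sM] <-]]|[dM sM]].
- split=> [|N i mi]; first by rewrite rk0 // deg0.
  by have zN := monic_zero mi zM; rewrite rk0 // deg0.
- split=> [|N i mi]; first by rewrite slopeE.
  case: (EM (is_zero N)) => [zN|nzN]; first by rewrite rk0 // deg0.
  by rewrite -slope_le //; apply: sM mi nzN.
- case: (EM (is_zero M)) => [zM|nzM]; [by left|right].
  have sl : slope r d M = l.
    by apply: (ogMn_inj hL (rk_gt0 nzM)); rewrite slopeE.
  by split=> //; split=> // N i mi nzN; rewrite sl slope_le //; apply: sM mi.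
Qed.

Lemma lpure_iso l M N (f : hom M N) : is_iso f -> lpure l M -> lpure l N.
Proof.
move=> iso_f; have MN : isomorphic M N by exists f.
have [g [gf fg]] := iso_f.
have mg : monic g.
  by apply: (@monic_of_comp _ _ _ _ f); rewrite fg; apply/is_iso_monic/idm_iso.
move=> [dM sM]; split=> [|X i mi].
  by rewrite -(deg_iso d MN) -(rk_iso r MN).
by apply: (sM _ (g \oc i)); apply: monic_comp.
Qed.

(** Away from zero objects, l <= slope M <= slope N <= l, and the equality clause of
    [slope_function] applies. *)
Lemma epic_monic_iso l M N (f : hom M N) : epic f -> monic f ->
  l *+ r M <= d M -> d N <= l *+ r N -> is_iso f.
Proof.
move=> ef mf dM dN.
case: (EM (is_zero M)) => [zM|nzM]; first exact: is_zero_iso (epic_zero ef zM).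
case: (EM (is_zero N)) => [zN|nzN]; first by case: nzM; apply: monic_zero mf zN.
rewrite -slope_ge // in dM; rewrite -slope_le // in dN.
have [le_MN [/(_ _) iso_f _]] := hmu nzM nzN ef mf; apply: iso_f.
by apply: le_anti; rewrite le_MN (le_trans dN dM).
Qed.

(** Semistability bounds the degree of the kernel from above, so additivity bounds that of the
    quotient from below. *)
Lemma lpure_quot l M K I (k : hom K M) (p : hom M I) :
  lpure l M -> ses k p -> l *+ r I <= d I.
Proof.
move=> [dM sM] s; have mk : monic k by case: s => [[]].
apply/(ogD2r hL (d K)); rewrite [d I + _]addrC -(degD s) dM (rkD s).
by rewrite mulrnDr addrC; apply/(ogD2r hL)/sM/mk.
Qed.

Lemma lpure_hom0 l m M N (f : hom M N) :
  lpure l M -> lpure m N -> m < l -> f = 0.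
Proof.
move=> pM [_ sN] ml; have [K [k [I [p [i [_ s fE mi]]]]]] := coimage f.
have h := le_trans (lpure_quot pM s) (sN _ _ mi).
case: (EM (is_zero I)) => [zI|/rk_gt0 nz].
  by rewrite fE (hom_to_zero p 0 zI) comp0r.
by rewrite ogMn_le // in h; have := le_lt_trans h ml; rewrite ltxx.
Qed.

Section MorphismsOfPures.
Variables (l : L) (M N : C) (f : hom M N).
Hypotheses (pM : lpure l M) (pN : lpure l N).

(** The equality for I is recorded because, by additivity, it gives kernel and cokernel degree
    exactly l times their rank. *)
Lemma lpure_factor : exists K (k : hom K M) I (p : hom M I) (i : hom I N),
  [/\ kr f k, ses k p, f = i \oc p, emb i & d I = l *+ r I].
Proof.
have [K [k [I [p [i [krk s fE mi]]]]]] := coimage f.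
have [Q [q [J [j [p' [ckq s' fE' ep']]]]]] := image f.
have cp := ses_cov s; have [[qj mj uj] _] := s'.
have [u ju] : exists u, j \oc u = i.
  apply: uj; apply: (cov_epic cp).
  by rewrite -compA -fE; case: ckq => ->; rewrite comp0l.
have up : u \oc p = p' by apply: mj; rewrite compA ju -fE fE'.
have mu : monic u by apply: (@monic_of_comp _ _ _ _ j); rewrite ju.
have eu : epic u.
  by move=> T a b e; apply: ep'; rewrite -up !compA e.
have iso_u : is_iso u.
  apply: (@epic_monic_iso l) => //; first exact: lpure_quot s.
  by case: pN => _ h; apply: h mj.
exists K, k, I, p, i; split=> //.
  by rewrite -ju; apply: emb_comp; [apply: ses_emb s' | apply: is_iso_emb].
apply: le_anti; rewrite (lpure_quot pM s) andbT.
by case: pN => _ h; apply: h mi.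
Qed.

Lemma lpure_qstrict : qstrict f.
Proof.
have [K [k [I [p [i [_ s fE ei _]]]]]] := lpure_factor.
by exists I, p, i; split=> //; apply: ses_cov s.
Qed.

Lemma lpure_kr K (k : hom K M) : kr f k -> lpure l K.
Proof.
have [K' [k' [I [p [i [krk' s fE ei dI]]]]]] := lpure_factor.
move=> krk; have [u [_ iu]] := kr_unique krk krk'.
apply: (lpure_iso iu); split; last first.
  move=> X j mj; case: pM => _ h; apply: (h _ (k' \oc j)).
  by apply: monic_comp => //; case: krk'.
apply: (addIr (d I)); rewrite -(degD s) dI -mulrnDr -(rkD s).
by case: pM.
Qed.

(** A subobject X of Q is pulled back to a subobject T of N, an extension of X by I. The bound on T
    and the equality for I give the bound on X. *)
Lemma lpure_ck Q (q : hom N Q) : ck f q -> lpure l Q.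
Proof.
have [K [k [I [p [i [krk s fE ei dI]]]]]] := lpure_factor.
move=> [qf eq uq]; have ep := cov_epic (ses_cov s); have [mi _] := ei.
have sN : ses i q.
  apply: emb_ses ei _; split=> //.
    by apply: ep; rewrite -compA -fE qf comp0l.
  by move=> T x xi; apply: uq; rewrite fE compA xi comp0l.
have [[qi _ uqi] _] := sN; split.
  apply: (addrI (d I)); rewrite -(degD sN) dI -mulrnDr -(rkD sN).
  by case: pN.
move=> X g mg; have [T [y [e pb]]] := pullback_exists q g.
have ce := cov_pullback pb (ses_cov sN); have [qy pbu] := pb.
have my : monic y.
  apply/monicP => S t yt; have et : e \oc t = 0.
    by apply: mg; rewrite compA -qy -compA yt !comp0r.
  have [|w [_ wu]] := pbu S 0 0; first by rewrite !comp0r.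
  by rewrite -(wu t) // -(wu 0) // !comp0r.
(* The inclusion of I in N factors through the pullback as [w], which is the kernel of [e]. *)
have [|w [[yw ew] _]] := pbu I i 0; first by rewrite comp0r.
have sT : ses w e.
  apply: (cov_ses ce); split=> //.
    by apply: (@monic_of_comp _ _ _ _ y); rewrite yw.
  move=> S z ez; have [|v iv] := uqi _ (y \oc z).
    by rewrite compA qy -compA ez comp0r.
  by exists v; apply: my; rewrite compA yw.
apply/(ogD2r hL (d I)); rewrite addrC -(degD sT) dI -mulrnDr addnC -(rkD sT).
by case: pN => _ h; apply: h my.
Qed.

End MorphismsOfPures.

(** A subobject of N is cut by [g] into a part that embeds in M and a coimage that embeds in P; the
    two bounds add up. *)
Lemma lpure_ext l M N P (f : hom M N) (g : hom N P) :
  ses f g -> lpure l M -> lpure l P -> lpure l N.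
Proof.
move=> s [dM sM] [dP sP]; split=> [|X x mx].
  by rewrite (degD s) (rkD s) dM dP mulrnDr.
have [K [k [I [p [i [[gxk mk _] sX gx mi]]]]]] := coimage (g \oc x).
have [[_ mf uf] _] := s.
have [|y fy] := uf _ (x \oc k); first by rewrite compA.
rewrite (degD sX) (rkD sX) mulrnDr; apply: (ogD hL) => //; last exact: sP mi.
apply: (sM _ y); apply: (@monic_of_comp _ _ _ _ f); rewrite fy.
exact: monic_comp.
Qed.

Lemma lpure_biproduct l X Y (S : biproduct (qadd C) X Y) :
  lpure l X -> lpure l Y -> lpure l S.
Proof. exact/lpure_ext/biproduct_ses. Qed.

Lemma lpure_zero l Z : is_zero Z -> lpure l Z.
Proof. by move=> zZ; apply/lpureP; left. Qed.

End Slopes.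

(** * Functor categories *)

Lemma dchoice (I : Type) (T : I -> Type) (P : forall i, T i -> Prop) :
  (forall i, exists x, P i x) -> exists f, forall i, P i (f i).
Proof. by move=> h; exists (fun i => sval (cid (h i))) => i; apply: svalP. Qed.

Section BiproductMaps.
Variable C : qacat.
Implicit Types X Y Z T : C.

Lemma bip_eq X Y (S : biproduct (qadd C) X Y) T (x y : hom T S) :
  bpr1 S \oc x = bpr1 S \oc y -> bpr2 S \oc x = bpr2 S \oc y -> x = y.
Proof.
move=> e1 e2; rewrite -[x]comp_idl -[y]comp_idl -(bsumE S) !hcompDl -!compA.
by rewrite e1 e2.
Qed.

Definition bmap X Y X' Y' (S : biproduct (qadd C) X Y)
    (S' : biproduct (qadd C) X' Y') (f : hom X X') (g : hom Y Y') : hom S S' :=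
  bin1 S' \oc f \oc bpr1 S + bin2 S' \oc g \oc bpr2 S.

Lemma bmap_in1 X Y X' Y' S S' (f : hom X X') (g : hom Y Y') :
  bmap S S' f g \oc bin1 S = bin1 S' \oc f.
Proof. by rewrite compDl -!compA bpr1_in1 bpr2_in1 !hcomp0r comp_idr addr0. Qed.

Lemma bmap_in2 X Y X' Y' S S' (f : hom X X') (g : hom Y Y') :
  bmap S S' f g \oc bin2 S = bin2 S' \oc g.
Proof. by rewrite compDl -!compA bpr2_in2 bpr1_in2 !hcomp0r comp_idr add0r. Qed.

Lemma bmap_pr1 X Y X' Y' S S' (f : hom X X') (g : hom Y Y') :
  bpr1 S' \oc bmap S S' f g = f \oc bpr1 S.
Proof. by rewrite compDr !compA bpr1_in1 bpr1_in2 !hcomp0l comp_idl addr0. Qed.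

Lemma bmap_pr2 X Y X' Y' S S' (f : hom X X') (g : hom Y Y') :
  bpr2 S' \oc bmap S S' f g = g \oc bpr2 S.
Proof. by rewrite compDr !compA bpr2_in1 bpr2_in2 !hcomp0l comp_idl add0r. Qed.

Lemma bmap_id X Y (S : biproduct (qadd C) X Y) :
  bmap S S (idm X) (idm Y) = idm S.
Proof. by rewrite /bmap !comp_idr; apply: bsumE. Qed.

Lemma bmap_comp X Y X' Y' X'' Y'' (S : biproduct (qadd C) X Y)
    (S' : biproduct (qadd C) X' Y') (S'' : biproduct (qadd C) X'' Y'')
    (f' : hom X' X'') (g' : hom Y' Y'') (f : hom X X') (g : hom Y Y') :
  bmap S S'' (f' \oc f) (g' \oc g) = bmap S' S'' f' g' \oc bmap S S' f g.
Proof.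
apply: bip_eq.
  by rewrite bmap_pr1 [RHS]compA bmap_pr1 -[RHS]compA bmap_pr1 compA.
by rewrite bmap_pr2 [RHS]compA bmap_pr2 -[RHS]compA bmap_pr2 compA.
Qed.

Lemma bmap_iso X Y X' Y' S S' (f : hom X X') (g : hom Y Y') :
  is_iso f -> is_iso g -> is_iso (bmap S S' f g).
Proof.
move=> [f' [f'f ff']] [g' [g'g gg']]; exists (bmap S' S f' g').
by rewrite -!bmap_comp f'f ff' g'g gg' !bmap_id.
Qed.

Lemma biproduct_zero X Y (S : biproduct (qadd C) X Y) :
  is_zero X -> is_zero Y -> is_zero S.
Proof.
move=> zX zY; apply/zeroP; apply: bip_eq; exact: hom_to_zero.
Qed.

Lemma ses_bmap X Y X' Y' X'' Y'' (S : biproduct (qadd C) X Y)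
    (S' : biproduct (qadd C) X' Y') (S'' : biproduct (qadd C) X'' Y'')
    (p : hom X' X'') (q : hom Y' Y'') (f : hom X X') (g : hom Y Y') :
  ses f p -> ses g q -> ses (bmap S S' f g) (bmap S' S'' p q).
Proof.
move=> sf sg; apply: cov_ses.
  exact: ext_cov (biproduct_ses S') (biproduct_ses S'') (bmap_in1 _ _ _ _)
    (bmap_pr2 _ _ _ _) (ses_cov sf) (ses_cov sg).
have [[pf mf uf] _] := sf; have [[qg mg ug] _] := sg; split.
- rewrite -bmap_comp pf qg; apply: bip_eq.
    by rewrite bmap_pr1 comp0l comp0r.
  by rewrite bmap_pr2 comp0l comp0r.
- apply/monicP => T x e0; apply: bip_eq.
    by rewrite comp0r; apply: ((monicP f).1 mf);
      rewrite compA -(bmap_pr1 S S' f g) -compA e0 comp0r.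
  by rewrite comp0r; apply: ((monicP g).1 mg);
      rewrite compA -(bmap_pr2 S S' f g) -compA e0 comp0r.
- move=> T x e0.
  have [|u fu] := uf _ (bpr1 S' \oc x).
    by rewrite compA -(bmap_pr1 S' S'' p q) -compA e0 comp0r.
  have [|v gv] := ug _ (bpr2 S' \oc x).
    by rewrite compA -(bmap_pr2 S' S'' p q) -compA e0 comp0r.
  exists (bin1 S \oc u + bin2 S \oc v); apply: bip_eq.
    rewrite compA bmap_pr1 -compA compDr !compA bpr1_in1 bpr1_in2 comp_idl.
    by rewrite hcomp0l addr0.
  rewrite compA bmap_pr2 -compA compDr !compA bpr2_in1 bpr2_in2 comp_idl.
  by rewrite hcomp0l add0r.
Qed.

End BiproductMaps.

Section FunctorKernels.
Variables (J : category) (C : qacat).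
Implicit Types F G H K Q : functor J C.

(** A kernel is chosen at each object; monicity makes the induced transition maps unique, hence
    functorial. *)
Lemma nt_kernel F G (t : nat_trans F G) :
  exists K (k : nat_trans K F), forall j, kr (t j) (k j).
Proof.
have [K0 /dchoice[k0 k0P]] := dchoice (fun j => kr_exists (t j)).
have m j : monic (k0 j) by case: (k0P j).
have ex i j (a : hom i j) : exists u, k0 j \oc u = fmap F a \oc k0 i.
  have [_ _ uj] := k0P j; have [fk _ _] := k0P i.
  by apply: uj; rewrite compA nt_natural -compA fk comp0r.
pose u i j a := sval (cid (ex i j a)).
have uP i j a : k0 j \oc u i j a = fmap F a \oc k0 i.
  exact: (svalP (cid (ex i j a))).
have uid i : u i i (idm i) = idm (K0 i).
  by apply: m; rewrite uP fmap_id comp_idl comp_idr.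
have uc i j l (b : hom j l) (a : hom i j) :
    u i l (b \oc a) = u j l b \oc u i j a.
  by apply: m; rewrite uP fmap_comp compA uP -!compA uP.
by exists (Functor uid uc), (@NatTrans _ _ (Functor uid uc) F k0 uP).
Qed.

Lemma nt_cokernel F G (t : nat_trans F G) :
  exists Q (q : nat_trans G Q), forall j, ck (t j) (q j).
Proof.
have [Q0 /dchoice[q0 q0P]] := dchoice (fun j => ck_exists (t j)).
have e j : epic (q0 j) by case: (q0P j).
have ex i j (a : hom i j) : exists u, q0 j \oc fmap G a = u \oc q0 i.
  have [_ _ ui] := q0P i; have [qf _ _] := q0P j.
  suff [u uq] : exists u, u \oc q0 i = q0 j \oc fmap G a by exists u.
  by apply: ui; rewrite -compA -nt_natural compA qf comp0l.
pose u i j a := sval (cid (ex i j a)).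
have uP i j a : q0 j \oc fmap G a = u i j a \oc q0 i.
  exact: (svalP (cid (ex i j a))).
have uid i : u i i (idm i) = idm (Q0 i).
  by apply: e; rewrite -uP fmap_id comp_idl comp_idr.
have uc i j l (b : hom j l) (a : hom i j) :
    u i l (b \oc a) = u j l b \oc u i j a.
  by apply: e; rewrite -uP fmap_comp compA uP -!compA uP.
by exists (Functor uid uc), (@NatTrans _ _ G (Functor uid uc) q0 uP).
Qed.

Lemma nt_kr_lift F G K T (t : nat_trans F G) (k : nat_trans K F)
    (x : nat_trans T F) :
  (forall j, kr (t j) (k j)) -> (forall j, t j \oc x j = 0) ->
  exists! u : nat_trans T K, nt_comp k u = x.
Proof.
move=> kP tx; have ex j : exists u, k j \oc u = x j.
  by case: (kP j) => _ _; apply.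
have [u uP] := dchoice ex.
have un i j (a : hom i j) : u j \oc fmap T a = fmap K a \oc u i.
  case: (kP j) => _ m _; apply: m.
  by rewrite compA uP nt_natural compA nt_natural -compA uP.
exists (NatTrans un); split; first exact: nat_trans_eq.
move=> v vE; apply: nat_trans_eq => j /=.
by case: (kP j) => _ m _; apply: m; rewrite uP -vE.
Qed.

Lemma nt_ck_lift F G Q T (t : nat_trans F G) (q : nat_trans G Q)
    (x : nat_trans G T) :
  (forall j, ck (t j) (q j)) -> (forall j, x j \oc t j = 0) ->
  exists! u : nat_trans Q T, nt_comp u q = x.
Proof.
move=> qP xt; have ex j : exists u, u \oc q j = x j.
  by case: (qP j) => _ _; apply.
have [u uP] := dchoice ex.
have un i j (a : hom i j) : u j \oc fmap Q a = fmap T a \oc u i.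
  case: (qP i) => _ e _; apply: e.
  by rewrite -compA -nt_natural compA uP nt_natural -compA uP.
exists (NatTrans un); split; first exact: nat_trans_eq.
move=> v vE; apply: nat_trans_eq => j /=.
by case: (qP j) => _ e _; apply: e; rewrite uP -vE.
Qed.

Lemma nt_iso F G (t : nat_trans F G) : (forall j, is_iso (t j)) ->
  exists s : nat_trans G F, nt_comp s t = nt_id F /\ nt_comp t s = nt_id G.
Proof.
move=> it; have [s sP] := dchoice it.
have st j := (sP j).1; have ts j := (sP j).2.
have sn i j (a : hom i j) : s j \oc fmap G a = fmap F a \oc s i.
  rewrite -[LHS]comp_idr -(ts i) -compA (compA (fmap G a)) -nt_natural !compA.
  by rewrite st comp_idl.
by exists (NatTrans sn); split; apply: nat_trans_eq.
Qed.

Section NTAdd.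
Variables (F G : functor J C).
Implicit Types s t : nat_trans F G.

Lemma nt_add_natural s t i j (a : hom i j) :
  (s j + t j) \oc fmap F a = fmap G a \oc (s i + t i).
Proof. by rewrite compDl compDr !nt_natural. Qed.

Lemma nt_opp_natural s i j (a : hom i j) :
  (- s j) \oc fmap F a = fmap G a \oc (- s i).
Proof. by rewrite compNl compNr nt_natural. Qed.

Lemma nt_zero_natural i j (a : hom i j) :
  (0 : hom (F j) (G j)) \oc fmap F a = fmap G a \oc 0.
Proof. by rewrite comp0l comp0r. Qed.

End NTAdd.

(** Closed by [Defined] because zeros and sums of natural transformations must compute level by
    level. *)
Definition nt_preadditive : preadditive (fun_cat J C).
Proof.
refine (@Preadditive (fun_cat J C)
  (fun F G s t => NatTrans (nt_add_natural s t))
  (fun F G => NatTrans (@nt_zero_natural F G))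
  (fun F G s => NatTrans (nt_opp_natural s)) _ _ _ _ _ _).
- by move=> F G s t u; apply: nat_trans_eq => j; apply: addrA.
- by move=> F G s t; apply: nat_trans_eq => j; apply: addrC.
- by move=> F G s; apply: nat_trans_eq => j; apply: add0r.
- by move=> F G s; apply: nat_trans_eq => j; apply: addNr.
- by move=> F G H s t u; apply: nat_trans_eq => j; apply: compDl.
- by move=> F G H s t u; apply: nat_trans_eq => j; apply: compDr.
Defined.

Lemma const_map_comp (Z : C) (i j l : J) (b : hom j l) (a : hom i j) :
  idm Z = idm Z \oc idm Z.
Proof. by rewrite comp_idl. Qed.

Definition const_functor (Z : C) : functor J C :=
  @Functor J C (fun _ => Z) (fun _ _ _ => idm Z) (fun _ => erefl)
    (@const_map_comp Z).

Lemma const_functor_zero Z :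
  is_zero Z -> @is_zero (fun_cat J C) (const_functor Z).
Proof.
move=> zZ; apply/(is_zeroP nt_preadditive); apply: nat_trans_eq => j /=.
exact: hom_to_zero.
Qed.

Lemma functor_zeroP F : @is_zero (fun_cat J C) F <-> forall j, is_zero (F j).
Proof.
split=> [/(is_zeroP nt_preadditive) e j|z].
  by apply/zeroP; have := congr1 (fun t : nat_trans F F => t j) e.
apply/(is_zeroP nt_preadditive); apply: nat_trans_eq => j /=.
exact/hom_to_zero.
Qed.

Section Biproduct.
Variables F G : functor J C.

Let S j := qbip (F j) (G j).

Lemma fbip_id i :
  bmap (S i) (S i) (fmap F (idm i)) (fmap G (idm i)) = idm (S i).
Proof. by rewrite !fmap_id bmap_id. Qed.

Lemma fbip_comp i j l (b : hom j l) (a : hom i j) :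
  bmap (S i) (S l) (fmap F (b \oc a)) (fmap G (b \oc a)) =
  bmap (S j) (S l) (fmap F b) (fmap G b) \oc
  bmap (S i) (S j) (fmap F a) (fmap G a).
Proof. by rewrite !fmap_comp (bmap_comp _ (S j)). Qed.

Definition fbip : functor J C := Functor fbip_id fbip_comp.

Definition nt_biproduct : biproduct nt_preadditive F G.
Proof.
refine (@Biproduct _ nt_preadditive F G fbip
  (@NatTrans _ _ F fbip (fun j => bin1 (S j)) _)
  (@NatTrans _ _ G fbip (fun j => bin2 (S j)) _)
  (@NatTrans _ _ fbip F (fun j => bpr1 (S j)) _)
  (@NatTrans _ _ fbip G (fun j => bpr2 (S j)) _) _ _ _ _ _).
- by apply: nat_trans_eq => j; apply: bpr1_in1.
- by apply: nat_trans_eq => j; apply: bpr2_in2.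
- by apply: nat_trans_eq => j; apply: bpr1_in2.
- by apply: nat_trans_eq => j; apply: bpr2_in1.
- by apply: nat_trans_eq => j; apply: bsumE.
Unshelve.
- by move=> i j a; rewrite bmap_in1.
- by move=> i j a; rewrite bmap_in2.
- by move=> i j a; rewrite bmap_pr1.
- by move=> i j a; rewrite bmap_pr2.
Defined.

End Biproduct.

End FunctorKernels.

(** * Filtrations *)

(** Makes the number of points of s in a range a decreasing measure for the inductions on breaks. *)
Lemma count_lt (T : eqType) (P Q : pred T) (s : seq T) (b : T) :
  subpred P Q -> b \in s -> Q b -> ~~ P b -> (count P s < count Q s)%N.
Proof.
move=> PQ; elim: s => //= a s IH; rewrite inE => /orP[/eqP<-|bs] Qb Pb.
  by rewrite (negbTE Pb) Qb add0n add1n ltnS sub_count.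
apply: leq_ltn_trans (_ : P a + count P s <= Q a + count P s)%N _.
  by rewrite leq_add2r; case: (boolP (P a)) => // /PQ->.
by rewrite ltn_add2l IH.
Qed.

Lemma ck_map_iso (C : qacat) (X Y X' Y' Q Q' : C) (f : hom X Y) (f' : hom X' Y')
    (q : hom Y Q) (q' : hom Y' Q') (x : hom X X') (y : hom Y Y')
    (u : hom Q Q') :
  f' \oc x = y \oc f -> is_iso x -> is_iso y -> ck f q -> ck f' q' ->
  u \oc q = q' \oc y -> is_iso u.
Proof.
move=> fx [x' [x'x xx']] [y' [y'y yy']] [qf eq uq] [qf' eq' uq'] uE.
have fx' : f \oc x' = y' \oc f'.
  rewrite -[f]comp_idl -y'y -compA -(compA y') (compA y) -fx -compA xx'.
  by rewrite comp_idr.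
have [v vq'] : exists v, v \oc q' = q \oc y'.
  by apply: uq'; rewrite -compA -fx' compA qf comp0l.
exists v; split.
  by apply: eq; rewrite -compA uE compA vq' -compA y'y comp_idl comp_idr.
by apply: eq'; rewrite -compA vq' compA uE -compA yy' comp_idl comp_idr.
Qed.

Lemma kr_map_iso (C : qacat) (X Y X' Y' K K' : C) (f : hom X Y) (f' : hom X' Y')
    (k : hom K X) (k' : hom K' X') (x : hom X X') (y : hom Y Y')
    (u : hom K K') :
  f' \oc x = y \oc f -> is_iso x -> is_iso y -> kr f k -> kr f' k' ->
  k' \oc u = x \oc k -> is_iso u.
Proof.
move=> fx [x' [x'x xx']] [y' [y'y yy']] [fk mk uk] [fk' mk' uk'] uE.
have fx' : f \oc x' = y' \oc f'.
  rewrite -[f]comp_idl -y'y -compA -(compA y') (compA y) -fx -compA xx'.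
  by rewrite comp_idr.
have [v kv] : exists v, k \oc v = x' \oc k'.
  by apply: uk; rewrite compA fx' -compA fk' comp0r.
exists v; split.
  by apply: mk; rewrite compA kv -compA uE compA x'x comp_idl comp_idr.
by apply: mk'; rewrite compA uE -compA kv compA xx' comp_idl comp_idr.
Qed.

(** * Functors with finitely many steps, and their morphisms *)

Section Stepped.
Variables (L : porderZmodType) (hL : ordered_divisible_group L) (C : qacat).
Variables (r : rank_function C) (d : degree_function C L).
Hypothesis hmu : slope_function r d.
Local Notation Fun := (fun_cat (poset_cat L) C).
Local Notation pureL := (lpure r d).
Local Notation tr W h := (@fmap (poset_cat L) (qcat C) W _ _ h).

(** Neither [b \in s] nor [b <= m] is demanded: the passage from l to m may cross no point of s at
    all. *)
Definition only_break (s : seq L) (l m b : L) :=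
  forall x, x \in s -> l < x <= m -> x = b.

(* s contains the breaks of W, but its elements need not all be breaks, so that
   two filtrations can be compared along a common s. *)
Definition stepped (s : seq L) (W : Fun) :=
  [/\ forall l, (forall b, b \in s -> l < b) -> is_zero (W l),
      forall l m (h : l <= m), (forall b, b \in s -> ~~ (l < b <= m)) ->
        is_iso (tr W h),
      forall l m b (h : l <= m), l < b -> only_break s l m b ->
        exists (G : C) (q : hom (W m) G), ses (tr W h) q /\ pureL b G
    & forall m b, (forall x, x \in s -> x <= m -> x = b) -> pureL b (W m)].

Lemma stepped_sub s s' W : {subset s <= s'} -> stepped s W -> stepped s' W.
Proof.
move=> ss' [z i e f]; split.
- by move=> l h; apply: z => b /ss'/h.
- by move=> l m lm h; apply: i => b /ss'/h.
- by move=> l m b lm lb h; apply: e => // x /ss'/h.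
- by move=> m b h; apply: f => // x /ss'/h.
Qed.

Lemma tr_comp (W : Fun) l m n (lm : l <= m) (mn : m <= n) (ln : l <= n) :
  tr W mn \oc tr W lm = tr W ln.
Proof.
by rewrite -(@fmap_comp (poset_cat L)); congr fmap; apply: bool_irrelevance.
Qed.

Lemma max_exists (s : seq L) (P : pred L) : (exists2 x, x \in s & P x) ->
  exists b, [/\ b \in s, P b & forall x, x \in s -> P x -> x <= b].
Proof.
elim: s => [[x]|a s IH [x]] //; rewrite inE => xs Px.
case: (EM (exists2 x, x \in s & P x)) => [/IH[b [bs Pb bm]]|no]; last first.
  case/orP: xs => [/eqP xa|xs]; last by case: no; exists x.
  exists a; rewrite mem_head -xa; split=> // y; rewrite inE.
  move=> /orP[/eqP->|ys Py].
    by rewrite xa lexx.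
  by case: no; exists y.
case: (ogtot hL a b) => [ab|ba].
  exists b; rewrite inE bs orbT; split=> // y; rewrite inE.
  move=> /orP[/eqP->|ys] // Py.
  exact: bm.
case Pa: (P a).
  exists a; rewrite mem_head; split=> // y; rewrite inE.
  move=> /orP[/eqP->|ys] // Py.
  exact: le_trans (bm _ ys Py) (ltW ba).
exists b; rewrite inE bs orbT; split=> // y; rewrite inE => /orP[/eqP->|ys] Py.
  by rewrite Pa in Py.
exact: bm.
Qed.

Section Morphism.
Variables (s : seq L) (W V : Fun) (f : nat_trans W V).
Hypotheses (sW : stepped s W) (sV : stepped s V).
Variables (K : Fun) (k : nat_trans K W) (Q : Fun) (q : nat_trans V Q).
Hypotheses (kP : forall l, kr (f l) (k l)) (qP : forall l, ck (f l) (q l)).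

(** The form in which the induction remembers that the cokernel at l is built from slopes at most
    l. *)
Definition nohom l X := forall b P (g : hom P X), l < b -> pureL b P -> g = 0.

(** The kernel and cokernel of the induced [f''] on graded pieces are pure of slope b. As l < b,
    [nohom] makes Hom(K'', Q l) vanish, so both snake sequences exist and have these objects as
    graded pieces. *)
Lemma step_ses l m b (h : l <= m) : l < b -> only_break s l m b ->
  qstrict (f l) -> nohom l (Q l) ->
  [/\ qstrict (f m),
      exists G (p : hom (K m) G), ses (tr K h) p /\ pureL b G
    & exists G (p : hom (Q m) G), ses (tr Q h) p /\ pureL b G].
Proof.
move=> lb ob sf nh.
have [_ _ /(_ l m b h lb ob) [G [p [sG pG]]] _] := sW.
have [_ _ /(_ l m b h lb ob) [H [p' [sH pH]]] _] := sV.
have fi : f m \oc tr W h = tr V h \oc f l by exact: nt_natural.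
have [p'h _] : p' \oc tr V h = 0 /\ True by case: sH => [[]].
have [f'' f''p] : exists f'', f'' \oc p = p' \oc f m.
  have [_ [_ _ up]] := sG; apply: up.
  by rewrite -compA fi compA p'h comp0l.
have [K'' [k'' krk'']] := kr_exists f''.
have [Q'' [q'' ckq'']] := ck_exists f''.
have pK := lpure_kr hL hmu pG pH krk''.
have pQ := lpure_ck hL hmu pG pH ckq''.
have sf'' := lpure_qstrict hL hmu f'' pG pH.
have hom0 (g : hom K'' (Q l)) : g = 0 by apply: nh lb pK.
have [a ka] : exists a, k'' \oc a = p \oc k m.
  have [_ _ uk] := krk''; apply: uk; have [fk _ _] := kP m.
  by rewrite compA f''p -compA fk comp0r.
have [c cq] : exists c, c \oc q m = q'' \oc p'.
  have [_ _ uq] := qP m; apply: uq; have [qf _ _] := ckq''.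
  by rewrite -compA -f''p compA qf comp0l.
have sK : ses (tr K h) a.
  apply: (snake_ker sG sH fi (esym f''p) (kP l) (kP m) krk'' _ ka sf (qP l)).
    exact: nt_natural.
  exact: hom0.
split.
- exact (snake_strict sG sH fi (esym f''p) (kP l) (kP m) krk'' ka sf sf'' sK).
- by exists K'', a.
- exists Q'', c; split=> //.
  apply: (snake_coker sG sH fi (esym f''p) (qP l) (qP m) ckq'' _ cq sf''
    krk'') => //.
  exact: esym (nt_natural q h).
Qed.

(** Strong induction on the number of points of s up to l. With b the last of them and l' the one
    before, both halves at l' are the input for crossing b. *)
Lemma stepped_strict l : qstrict (f l) /\ nohom l (Q l).
Proof.
elim: {l}_.+1 {-2}l (ltnSn (count (fun x => x <= l) s)) => // n IH l ln.
case: (EM (exists2 b, b \in s & b <= l)) => [/max_exists[b [bs bl bmax]]|no].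
  case: (EM (exists2 l', l' \in s & l' < b)) => [|no].
    move=> /max_exists[l' [l's l'b l'max]].
    have h : l' <= l by apply: ltW; apply: lt_le_trans bl.
    have ob : only_break s l' l b.
      move=> x xs /andP[l'x xl]; have := bmax _ xs xl; rewrite le_eqVlt.
      case/orP=> [/eqP //|/(l'max _ xs) xl'].
      by have := lt_le_trans l'x xl'; rewrite ltxx.
    have [|sf nh] := IH l'.
      (* The measure drops since b is counted up to l but not up to l'. *)
      rewrite -ltnS; apply: leq_trans ln; rewrite ltnS.
      apply: (count_lt (b := b)) => // [x xl'|].
        exact: le_trans xl' h.
      by apply/negP => bl'; have := lt_le_trans l'b bl'; rewrite ltxx.
    have [sfl _ [G [p [sQ pG]]]] := step_ses h l'b ob sf nh.
    (* A morphism from slope c > l dies in the graded piece, whose slope b is at most l, so it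
       factors through [Q l'], where the induction hypothesis kills it. *)
    split=> // c P g lc pP.
    have bc := le_lt_trans bl lc; have [[ph _ up] _] := sQ.
    have [|w <-] := up _ g; first exact: lpure_hom0 pP pG bc.
    by rewrite (nh c P w (lt_trans l'b bc) pP) comp0r.
  (* Here b is the only point up to l, so [W l] and [V l] are themselves pure of slope b. *)
  have ob x : x \in s -> x <= l -> x = b.
    move=> xs xl; have := bmax _ xs xl; rewrite le_eqVlt.
    by case/orP=> [/eqP //|xb]; case: no; exists x.
  have [_ _ _ /(_ _ _ ob) pW] := sW; have [_ _ _ /(_ _ _ ob) pV] := sV.
  split; first exact: lpure_qstrict pW pV.
  move=> c P g lc pP; have pQ := lpure_ck hL hmu pW pV (qP l).
  exact: lpure_hom0 pP pQ (le_lt_trans bl lc).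
have nb b : b \in s -> l < b.
  by move=> bs; case: (ogtot hL b l) => // bl; case: no; exists b.
have [/(_ _ nb) zW _ _ _] := sW; have [/(_ _ nb) zV _ _ _] := sV.
split.
  exists (W l), (idm (W l)), (f l); split.
  - by rewrite comp_idr.
  - exact/is_iso_cov/idm_iso.
  - exact/is_iso_emb/is_zero_iso.
move=> b P g _ _; apply: hom_to_zero.
by case: (qP l) => _ eq _; apply: epic_zero eq zV.
Qed.

(** The same s serves although the kernel may be constant across some of its points: the graded
    piece there is then zero, which is pure of every slope. *)
Lemma stepped_kernel : stepped s K.
Proof.
have [zW iW _ fW] := sW; have [_ iV _ fV] := sV; split.
- by move=> l /zW zl; case: (kP l) => _ mk _; apply: monic_zero mk zl.
- move=> l m h nb; apply: (kr_map_iso (esym _) (iW _ _ _ nb) (iV _ _ _ nb)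
    (kP l) (kP m)).
    by rewrite -(nt_natural f h).
  exact: nt_natural.
- move=> l m b h lb ob; have [sf nh] := stepped_strict l.
  by have [_ ? _] := step_ses h lb ob sf nh.
- by move=> m b ob; apply: (lpure_kr hL hmu (fW _ _ ob) (fV _ _ ob) (kP m)).
Qed.

Lemma stepped_cokernel : stepped s Q.
Proof.
have [_ iW _ fW] := sW; have [zV iV _ fV] := sV; split.
- by move=> l /zV zl; case: (qP l) => _ eq _; apply: epic_zero eq zl.
- move=> l m h nb; apply: (ck_map_iso (esym _) (iW _ _ _ nb) (iV _ _ _ nb)
    (qP l) (qP m)).
    by rewrite -(nt_natural f h).
  exact: esym (nt_natural q h).
- move=> l m b h lb ob; have [sf nh] := stepped_strict l.
  by have [_ _ ?] := step_ses h lb ob sf nh.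
- by move=> m b ob; apply: (lpure_ck hL hmu (fW _ _ ob) (fV _ _ ob) (qP m)).
Qed.

End Morphism.

Lemma stepped_biproduct s (W V : Fun) :
  stepped s W -> stepped s V -> stepped s (fbip W V).
Proof.
move=> [zW iW eW fW] [zV iV eV fV]; split.
- by move=> l nb; apply: biproduct_zero; [apply: zW | apply: zV].
- by move=> l m h nb; apply: bmap_iso; [apply: iW | apply: iV].
- move=> l m b h lb ob; have [G [p [sG pG]]] := eW l m b h lb ob.
  have [H [q [sH pH]]] := eV l m b h lb ob.
  exists (qbip G H), (bmap (qbip (W m) (V m)) (qbip G H) p q); split.
    exact: ses_bmap.
  exact: lpure_biproduct.
- by move=> m b ob; apply: lpure_biproduct; [|apply: fW|apply: fV].
Qed.

Lemma stepped_zero s (Z : Fun) : (forall l, is_zero (Z l)) -> stepped s Z.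
Proof.
move=> zZ; split=> //.
- by move=> l m h _; apply: is_zero_iso.
- move=> l m b h _ _; exists (Z m), (idm (Z m)); split; last exact: lpure_zero.
  rewrite (hom_to_zero (tr Z h) 0 (zZ m)); apply: cov_ses.
    exact/is_iso_cov/idm_iso.
  split; first by rewrite comp0r.
    by move=> T x y _; apply: hom_to_zero.
  by move=> T x _; exists 0; apply: hom_to_zero.
- by move=> m b _; apply: lpure_zero.
Qed.

End Stepped.

Lemma iso_ses (C : qacat) (X Y Z : C) (f : hom X Y) :
  is_iso f -> is_zero Z -> ses f (0 : hom Y Z).
Proof.
move=> iso_f zZ; apply: emb_ses; first exact: is_iso_emb.
split; first by rewrite comp0l.
  by move=> T x y _; apply: hom_from_zero.
move=> T x xf; exists 0; rewrite comp0l.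
by have [/epicP ef _] := is_iso_cov iso_f; rewrite (ef _ _ xf).
Qed.

Lemma ses_iso_comp (C : qacat) (X Y Y' Z : C) (f : hom X Y) (q : hom Y Z)
    (t : hom Y Y') :
  ses f q -> is_iso t -> exists q' : hom Y' Z, ses (t \oc f) q'.
Proof.
move=> sf [t' [t't tt']]; exists (q \oc t').
have [[qf mf uf] _] := sf; apply: cov_ses.
  by apply: cov_comp; [apply: ses_cov sf | apply: is_iso_cov; exists t].
split.
- by rewrite -compA (compA t') t't comp_idl.
- by apply: monic_comp => //; apply: is_iso_monic; exists t'.
- move=> T x; rewrite -compA => /uf[u fu]; exists u.
  by rewrite -compA fu compA tt' comp_idl.
Qed.

(** Serves twice: for the total object, with [t] beyond all breaks, and for W_{<m}, with [t] the
    last break before m. *)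
Lemma top_colimit (J C : category) (F : functor J C) (t : J) :
  (forall i j (a b : @hom J i j), a = b) ->
  (forall j, (exists a : hom j t, True) \/
    (exists a : hom t j, is_iso (fmap F a))) ->
  exists c : forall j, hom (F j) (F t), is_colimit c /\
    forall j, (forall a : hom j t, c j = fmap F a) /\
              (forall a : hom t j, c j \oc fmap F a = idm (F t)).
Proof.
move=> thin ht.
(* The component at j is the transition into [t] or the inverse of the transition out of it;
   thinness makes the two descriptions agree when both exist. *)
have ex j : exists c : hom (F j) (F t), (forall a : hom j t, c = fmap F a) /\
    (forall a : hom t j, c \oc fmap F a = idm (F t)).
  case: (ht j) => [[a _]|[a [g [gF Fg]]]].
    exists (fmap F a); split=> [b|b]; first by rewrite (thin _ _ a b).
    by rewrite -fmap_comp (thin _ _ (a \oc b) (idm t)) fmap_id.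
  exists g; split=> [b|b]; last by rewrite (thin _ _ b a).
  have e : fmap F b \oc fmap F a = idm _.
    by rewrite -fmap_comp (thin _ _ (b \oc a) (idm t)) fmap_id.
  by rewrite -[g]comp_idl -e -compA Fg comp_idr.
have [c cP] := dchoice ex.
have c1 j (a : hom j t) : c j = fmap F a by case: (cP j) => + _; apply.
have c2 j (a : hom t j) : c j \oc fmap F a = idm (F t).
  by case: (cP j) => _; apply.
have cancel j (a : hom t j) N (x y : hom (F j) N) : is_iso (fmap F a) ->
    x \oc fmap F a = y \oc fmap F a -> x = y.
  move=> [g [_ Fg]] e; rewrite -[x]comp_idr -[y]comp_idr -Fg !compA e.
  by [].
exists c; split; last exact: cP.
split.
  move=> i j a; case: (ht j) => [[b _]|[b ib]].
    by rewrite (c1 _ b) -fmap_comp (c1 _ (b \oc a)).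
  case: (ht i) => [[e _]|[e ie]].
    rewrite (thin _ _ a (b \oc e)) fmap_comp compA c2 comp_idl.
    by rewrite (c1 _ e).
  by apply: (cancel _ e) => //; rewrite -compA -fmap_comp !c2.
move=> N e eP; exists (e t); split=> [j|v vP].
  case: (ht j) => [[b _]|[b ib]]; first by rewrite (c1 _ b) eP.
  by apply: (cancel _ b) => //; rewrite -compA c2 comp_idr eP.
by rewrite -(vP t) (c1 _ (idm t)) fmap_id comp_idr.
Qed.

(** * Mixed structures are the stepped functors *)

Section MixedStepped.
Variables (L : porderZmodType) (hL : ordered_divisible_group L) (C : qacat).
Variables (r : rank_function C) (d : degree_function C L).
Local Notation Fun := (fun_cat (poset_cat L) C).
Local Notation pureL := (lpure r d).
Local Notation tr W h := (@fmap (poset_cat L) (qcat C) W _ _ h).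

Section ToStepped.
Variables (s : seq L) (W : Fun).
Hypotheses (W_zero : forall l, (forall b, b \in s -> l < b) -> is_zero (W l))
  (W_iso : forall l m (h : l <= m), (forall b, b \in s -> ~~ (l < b <= m)) ->
     is_iso (tr W h))
  (W_emb : forall l m (h : l <= m), emb (tr W h))
  (W_gr : forall l : L, exists G : C, is_gr W l G /\ pure r d l G).

(** The colimit V need not be identified with [W l]: it is enough that the cocone map from [W l] to
    V is epic, since precomposing [u] with an epic leaves its cokernel unchanged. *)
Lemma gr_step l b (h : l <= b) : l < b ->
  (forall x, x \in s -> l < x -> ~~ (x < b)) ->
  exists (G : C) (q : hom (W b) G), ses (tr W h) q /\ pureL b G.
Proof.
move=> lb nb; have [G [[V [c [u [q [[cc cu] uc /ckP[qu eq uq]]]]]]]] := W_gr b.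
move=> /(lpureP hL) pG; exists G, q; split=> //.
pose jl : below b := exist _ (l : poset_cat L) lb.
have ecl : epic (c jl).
  (* Agreement at l spreads to levels below l by composition, and to levels between l and b because
     no break separates them from l. *)
  move=> T x y e; have h0 (j : below b) : x \oc c j = y \oc c j.
    have [jb|jl'] := ogtot hL (sval j) l.
      have cE := cc j jl (jb : @hom (below b) j jl).
      by rewrite -cE !compA e.
    have cE := cc jl j (ltW jl' : @hom (below b) jl j).
    have [|g [_ gi]] := W_iso (ltW jl').
      move=> z zs; apply/negP => /andP[lz zj]; have := nb _ zs lz.
      by rewrite (le_lt_trans zj (svalP j)).
    have e' : x \oc c j \oc tr W (ltW jl') = y \oc c j \oc tr W (ltW jl').
      by rewrite -!compA; move: e; rewrite -cE.
    by rewrite -[LHS]comp_idr -[RHS]comp_idr -gi !compA e'.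
  have [|w [_ wu]] := cu T (fun j => x \oc c j).
    by move=> i j a; rewrite -compA cc.
  by rewrite -(wu x) // -(wu y) // => j; rewrite h0.
have trE : tr W h = u \oc c jl.
  by rewrite uc; congr fmap; apply: bool_irrelevance.
apply: emb_ses; first exact: W_emb.
rewrite trE; split=> //; first by rewrite compA qu comp0l.
move=> T x; rewrite compA => xu; apply: uq; apply: ecl; rewrite xu comp0l.
by [].
Qed.

(** W_{<b} is a colimit of zero objects, possibly an empty one, hence zero, so [W b] is its own
    graded piece. *)
Lemma gr_first b : (forall x, x \in s -> ~~ (x < b)) -> pureL b (W b).
Proof.
move=> nb; have [G [[V [c [u [q [[cc cu] uc /ckP[qu eq uq]]]]]]]] := W_gr b.
move=> /(lpureP hL) pG.
have zV : is_zero V.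
  apply/zeroP; have [|w [_ wu]] := cu V c; first exact: cc.
  rewrite -(wu (idm V)); last by move=> j; rewrite comp_idl.
  rewrite -(wu 0) // => j; apply: hom_from_zero; apply: W_zero => x xs.
  have [bx|xb] := ogtot hL b x; first exact: lt_le_trans (svalP j) bx.
  by have := nb x xs; rewrite xb.
have [|v vq] := uq _ (idm (W b)); first exact: hom_from_zero.
apply: (lpure_iso (f := v)) pG; exists q; split=> //.
by apply: eq; rewrite -compA vq comp_idl comp_idr.
Qed.

Lemma gr_stepped : stepped r d s W.
Proof.
split=> //.
- move=> l m b lm lb ob; have [bm|mb] := ogtot hL b m.
    have lb' := ltW lb; have [|G [q [sq pG]]] := gr_step lb' lb.
      move=> x xs lx; apply/negP => xb; have := ob x xs.
      rewrite lx (ltW (lt_le_trans xb bm)) => /(_ isT) xE.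
      by rewrite xE ltxx in xb.
    have ib : is_iso (tr W bm).
      apply: W_iso => x xs; apply/negP => /andP[bx xm]; have := ob x xs.
      by rewrite (lt_trans lb bx) xm => /(_ isT) xE; rewrite xE ltxx in bx.
    have [q' sq'] := ses_iso_comp sq ib; exists G, q'; split=> //.
    by move: sq'; rewrite (tr_comp W lb' bm lm).
  (* For m < b nothing is crossed between l and m; the graded piece is zero, which is pure of slope
     b. *)
  have [Z zZ] := qzero C; exists Z, 0; split; last exact: lpure_zero.
  apply: iso_ses zZ; apply: W_iso => x xs; apply/negP => lxm.
  by have := ob x xs lxm => xb; move: lxm; rewrite xb (lt_geF mb) andbF.
- move=> m b ob; have [bm|mb] := ogtot hL b m.
    have ib : is_iso (tr W bm).
      apply: W_iso => x xs; apply/negP => /andP[bx xm]; have := ob x xs xm.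
      by move=> xb; rewrite xb ltxx in bx.
    apply: lpure_iso ib _; apply: gr_first => x xs; apply/negP => xb.
    by have xE := ob x xs (ltW (lt_le_trans xb bm)); rewrite xE ltxx in xb.
  apply: lpure_zero => //; apply: W_zero => x xs.
  have [xm|//] := ogtot hL x m; have xb := ob x xs xm.
  by rewrite xb (lt_geF mb) in xm.
Qed.

End ToStepped.

(** The list of breaks serves as s. Since [finite_breaks] only speaks of transitions starting at a
    break, the one from l to m is compared with those from the last break b up to l. *)
Lemma mixed_stepped (W : Fun) : mixed r d W -> exists s, stepped r d s W.
Proof.
case=> [[M [c [[cc cu] sc [s [ss sM z i ci]]]]] gr]; exists s.
have ec l : emb (c l) by case: (sc l) => ? ?; apply: strict_monic_emb.
have z' l : (forall b, b \in s -> l < b) -> is_zero (W l).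
  by move=> h; apply: z; apply/allP.
apply: gr_stepped => //; last first.
  by move=> l m h; apply: (@emb_of_comp _ _ _ _ (c m)); rewrite cc.
move=> l m lm nb; case: (EM (exists2 b, b \in s & b <= l)); last first.
  move=> no; have hl b : b \in s -> l < b.
    by move=> bs; have [bl|//] := ogtot hL b l; case: no; exists b.
  apply: is_zero_iso; apply: z' => // b bs.
  have [bm|//] := ogtot hL b m; have := nb b bs.
  by rewrite hl // bm.
move=> /(max_exists hL)[b [bs bl bmax]].
have bm := le_trans bl lm.
have s_b : s`_(index b s) = b by exact: nth_index.
have b_lt : (index b s < size s)%N by rewrite index_mem.
case: (ltnP (index b s).+1 (size s)) => [i1|i1].
  have b_lt1 : b < s`_(index b s).+1.
    rewrite -{1}s_b; exact: (@sorted_ltn_nth _ _ (@lt_trans _ L) 0).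
  have l_lt : l < s`_(index b s).+1.
    have [bl1|//] := ogtot hL s`_(index b s).+1 l.
    by have := le_lt_trans (bmax _ (mem_nth 0 i1) bl1) b_lt1; rewrite ltxx.
  have m_lt : m < s`_(index b s).+1.
    have [bl1|//] := ogtot hL s`_(index b s).+1 m.
    by have := nb _ (mem_nth 0 i1); rewrite l_lt bl1.
  have bl' : s`_(index b s) <= l by rewrite s_b.
  have bm' : s`_(index b s) <= m by rewrite s_b.
  apply: (@is_iso_of_comp _ _ _ _ _ (tr W bl') (tr W bm')).
  - exact: tr_comp.
  - exact: i.
  - exact: i.
(* With b the last break, [c l] and [c m] are invertible and the transition is recovered from
   them. *)
have lst : last 0 s = b.
  rewrite -nth_last -s_b; congr nth; apply/eqP.
  by rewrite -eqSS prednK ?(leq_ltn_trans _ b_lt) // eqn_leq i1 b_lt.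
have sn0 : s <> [::] by move=> s0; rewrite s0 in bs.
have [cl' [cl1 cl2]] := ci l sn0 (eq_ind_r (fun x => x <= l) bl lst).
have [cm' [cm1 cm2]] := ci m sn0 (eq_ind_r (fun x => x <= m) bm lst).
have ccl : c m \oc tr W lm = c l := cc l m lm.
exists (cl' \oc c m); split; first by rewrite -compA ccl cl1.
have e : c m \oc (tr W lm \oc (cl' \oc c m)) = c m.
  by rewrite !compA ccl cl2 comp_idl.
by rewrite -[LHS]comp_idl -{1}cm1 -[LHS]compA e cm1.
Qed.

Section ToMixed.
Variables (s : seq L) (W : Fun).
Hypothesis sW : stepped r d s W.

(** Each single crossing is the kernel in a short exact sequence, and composites of strict monics
    are strict monics. *)
Lemma stepped_emb l m (h : l <= m) : emb (tr W h).
Proof.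
have [_ W_iso W_step _] := sW.
elim: {m}_.+1 {-2}m (ltnSn (count (fun x => l < x <= m) s)) h => // n IH m mn h.
case: (EM (exists2 b, b \in s & l < b <= m)); last first.
  move=> no; apply/is_iso_emb/W_iso => b bs; apply/negP => lbm; apply: no.
  by exists b.
move=> /(max_exists hL)[b [bs /andP[lb bm] bmax]].
case: (EM (exists2 l', l' \in s & l < l' < b)); last first.
  move=> no; have [|G [q [sq _]]] := W_step l m b h lb; last exact: ses_emb sq.
  move=> x xs lxm; have := bmax x xs lxm; rewrite le_eqVlt => /orP[/eqP //|xb].
  by case: no; exists x => //; rewrite xb andbT; case/andP: lxm.
move=> /(max_exists hL)[l' [l's /andP[ll' l'b] l'max]].
have l'm := ltW (lt_le_trans l'b bm); have h' := ltW ll'.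
rewrite -(tr_comp W h' l'm); apply: emb_comp.
  have [|G [q [sq _]]] := W_step l' m b l'm l'b; last exact: ses_emb sq.
  move=> x xs /andP[l'x xm]; have lx := lt_trans ll' l'x.
  have := bmax x xs; rewrite lx xm le_eqVlt => /(_ isT)/orP[/eqP //|xb].
  have := l'max x xs; rewrite lx xb => /(_ isT) xl'.
  by have := lt_le_trans l'x xl'; rewrite ltxx.
apply: IH; rewrite -ltnS; apply: leq_trans mn; rewrite ltnS.
apply: (count_lt (b := b)) => // [x /andP[lx xl']||].
- by rewrite lx (le_trans xl' l'm).
- by rewrite lb bm.
- by rewrite lb; apply/negP => bl'; have := lt_le_trans l'b bl'; rewrite ltxx.
Qed.

Lemma stepped_filtration : filtration W.
Proof.
have [W_zero W_iso _ _] := sW.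
(* The total object is read off at a level bounding s; for empty s any level does, here 0. *)
have [top topP] : exists top, forall b, b \in s -> b <= top.
  case: (EM (exists2 b, b \in s & predT b)) => [|no].
    move=> /(max_exists hL)[b [_ _ bP]].
    by exists b => x xs; apply: bP.
  by exists 0 => x xs; case: no; exists x.
have top_iso l (h : top <= l) : is_iso (tr W h).
  apply: W_iso => b bs; apply/negP => /andP[tb _].
  by have := le_lt_trans (topP b bs) tb; rewrite ltxx.
have [|l|c [ccol cP]] := @top_colimit (poset_cat L) C W top.
- by move=> i j a b; apply: bool_irrelevance.
- have [lt|tl] := ogtot hL l top; [by left; exists lt | right].
  by exists (ltW tl); apply: top_iso.
have c_iso l : top <= l -> is_iso (c l).
  move=> h; apply: is_iso_of_comp ((cP l).2 h) (idm_iso _) (top_iso _ h).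
have c_emb l : emb (c l).
  have [lt|/ltW/c_iso/is_iso_emb //] := ogtot hL l top.
  by rewrite ((cP l).1 lt); apply: stepped_emb.
exists (W top), c; split=> //; first by move=> l; apply: emb_strict.
(* [finite_breaks] wants the empty list exactly for the zero object, even when s itself has
   points. *)
case: (EM (is_zero (W top))) => [zM|nzM].
  exists [::]; split=> // l _; apply: monic_zero zM.
  by case: (c_emb l) => m _; exact: m.
have s0 : exists b, b \in s.
  case: (s) W_zero => [|b s'] W_zero; last by exists b; rewrite mem_head.
  by case: nzM; apply: W_zero.
have tot : total (<=%R : rel L) by case: hL.
pose s' := sort <=%R (undup s).
have ms x : (x \in s') = (x \in s) by rewrite mem_sort mem_undup.
have ss' : sorted <=%R s' by exact: sort_sorted.
have nth_mono i j : (i <= j)%N -> (j < size s')%N -> s'`_i <= s'`_j.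
  move=> ij js; have st := sorted_leq_nth (@le_trans _ L) (@lexx _ L) 0 ss'.
  apply: st => //.
  exact: leq_ltn_trans js.
have [b0 b0s] := s0.
have s'n0 : s' <> [::] by move=> e; rewrite -ms e in b0s.
exists s'; split.
- by rewrite lt_sorted_uniq_le sort_uniq undup_uniq.
- by split.
- move=> l /allP h; apply: W_zero => b; rewrite -ms; exact: h.
- move=> i l hl i1 li; apply: W_iso => x; rewrite -ms => xs.
  apply/negP => /andP[ix xl].
  have xi : (index x s' < size s')%N by rewrite index_mem.
  have [le_i|lt_i] := leqP (index x s') i.
    have := nth_mono _ _ le_i (ltnW i1); rewrite nth_index // => xi'.
    by have := lt_le_trans ix xi'; rewrite ltxx.
  have := nth_mono _ _ lt_i xi; rewrite nth_index // => xi'.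
  by have := lt_le_trans li (le_trans xi' xl); rewrite ltxx.
- move=> l _ hl; have [/c_iso //|lt] := ogtot hL top l.
  rewrite ((cP l).1 (ltW lt)); apply: W_iso => x; rewrite -ms => xs.
  apply/negP => /andP[lx _].
  have xi : (index x s' < size s')%N by rewrite index_mem.
  have : x <= last 0 s'.
    rewrite -nth_last -{1}(nth_index 0 xs); apply: nth_mono.
      by rewrite -ltnS prednK // (leq_ltn_trans _ xi).
    by rewrite prednK // (leq_ltn_trans _ xi).
  by move=> xl; have := lt_le_trans lx (le_trans xl hl); rewrite ltxx.
Qed.

Lemma stepped_gr m : exists G : C, is_gr W m G /\ pure r d m G.
Proof.
have [W_zero W_iso W_step W_first] := sW.
case: (EM (exists2 l, l \in s & l < m)) => [|no].
  move=> /(max_exists hL)[l [ls lm lmax]].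
  pose jl : below m := exist _ (l : poset_cat L) lm.
  have after (j : L) : j < m -> l < j -> forall b, b \in s -> ~~ (l < b <= j).
    move=> jm lj b bs; apply/negP => /andP[lb bj].
    have := lmax b bs (le_lt_trans bj jm) => bl.
    by have := lt_le_trans lb bl; rewrite ltxx.
  have [i j a b|j|c [ccol cP]] :=
    @top_colimit (below m) C (restrict_below W m) jl.
  - exact: bool_irrelevance.
  - have [jl'|lj] := ogtot hL (sval j) l; [by left; exists jl' | right].
    exists (ltW lj); apply: W_iso; apply: after lj; exact: svalP j.
  (* The step clause is used with slope m whether or not m lies in s: as l is the last point before
     m, only m can be crossed. *)
  have [|G [q [sq pG]]] := W_step l m m (ltW lm) lm.
    move=> x xs /andP[lx]; rewrite le_eqVlt => /orP[/eqP //|xm].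
    by have := lt_le_trans lx (lmax x xs xm); rewrite ltxx.
  exists G; split; last exact/(lpureP hL).
  exists (W l), c, (tr W (ltW lm)), q; split=> //; last by apply/ckP; case: sq.
  move=> j; have [jl'|lj] := ogtot hL (sval j) l.
    rewrite ((cP j).1 (jl' : @hom (below m) j jl)).
    exact: (@tr_comp L C W (sval j) l m).
  have [|g [_ gi]] := W_iso _ _ (ltW lj).
    by apply: after lj; exact: svalP j.
  have e := (cP j).2 (ltW lj : @hom (below m) jl j).
  rewrite -[LHS]comp_idr -[RHS]comp_idr -gi !compA; congr (_ \oc g).
  rewrite -compA; move: e => /= ->; rewrite comp_idr; symmetry.
  exact: (@tr_comp L C W l (sval j) m).
(* No point of s lies before m: W_{<m} is zero and [W m] is the graded piece. *)
have nb b : b \in s -> m <= b.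
  by move=> bs; have [//|bm] := ogtot hL m b; case: no; exists b.
have [Z zZ] := qzero C.
have zW (j : below m) : is_zero (W (sval j)).
  by apply: W_zero => b /nb; apply: lt_le_trans; exact: svalP j.
exists (W m); split; last first.
  apply/(lpureP hL)/W_first => x xs xm.
  by apply: le_anti; rewrite xm nb.
exists Z, (fun j => 0), 0, (idm (W m)); split.
- split=> [i j a|N e eP]; first exact: hom_to_zero.
  exists 0; split=> [j|v _]; last exact: hom_from_zero.
  by apply: hom_from_zero; apply: zW.
- by move=> j; apply: hom_from_zero; apply: zW.
- apply/ckP; split; first by rewrite comp0r.
    by have [] := is_iso_cov (idm_iso (W m)).
  by move=> T x _; exists x; rewrite comp_idr.
Qed.

Lemma stepped_mixed : mixed r d W.
Proof. by split; [apply: stepped_filtration | apply: stepped_gr]. Qed.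

End ToMixed.

End MixedStepped.

(** * Mixed structures *)

Section KernelTransport.
Variable D : category.
Implicit Types X Y K : D.

Lemma is_ker_unique X Y (f : hom X Y) K (k : hom K X) K' (k' : hom K' X) :
  is_ker f k -> is_ker f k' -> exists u, k \oc u = k' /\ is_iso u.
Proof.
move=> [fk uk] [fk' uk'].
have [u [ku _]] := uk _ _ fk'; have [v [kv _]] := uk' _ _ fk.
exists u; split=> //; exists v; split.
  have [w [_ wu]] := uk' _ _ fk'.
  by rewrite -(wu (v \oc u)) ?compA ?kv // -(wu (idm K')) // comp_idr.
have [w [_ wu]] := uk _ _ fk.
by rewrite -(wu (u \oc v)) ?compA ?ku // -(wu (idm K)) // comp_idr.
Qed.

Lemma is_ker_iso X Y (f : hom X Y) K (k : hom K X) K' (u : hom K' K) :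
  is_ker f k -> is_iso u -> is_ker f (k \oc u).
Proof.
move=> [[Z [a [b [zZ fk]]]] uk] [v [vu uv]]; split.
  by exists Z, (a \oc u), b; rewrite !compA fk.
move=> T g fg; have [w [kw wu]] := uk T g fg.
exists (v \oc w); split=> [|x ux].
  by rewrite compA -(compA k) uv comp_idr.
by rewrite (wu (u \oc x)) ?compA // vu comp_idl.
Qed.

End KernelTransport.

(** * Kernels and cokernels in full subcategories *)

Section FullSubcategories.
Variables (D : category) (P : D -> Prop) (A : preadditive D).
Hypothesis zP : exists Z : D, is_zero Z /\ P Z.
Local Notation S := (full_sub P).

Definition full_preadditive : preadditive S :=
  @Preadditive S (fun X Y => @hadd D A (sval X) (sval Y))
    (fun X Y => hzero A (sval X) (sval Y))
    (fun X Y => @hopp D A (sval X) (sval Y))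
    (fun X Y => @haddA D A (sval X) (sval Y))
    (fun X Y => @haddC D A (sval X) (sval Y))
    (fun X Y => @hadd0 D A (sval X) (sval Y))
    (fun X Y => @haddN D A (sval X) (sval Y))
    (fun X Y Z => @hcompDl D A (sval X) (sval Y) (sval Z))
    (fun X Y Z => @hcompDr D A (sval X) (sval Y) (sval Z)).

Lemma full_zero : exists Z : S, is_zero Z.
Proof.
case: zP => Z [[zl zr] PZ]; exists (exist _ Z PZ).
by split=> X; [apply: zl | apply: zr].
Qed.

(** Each category factors zero morphisms through its own zero objects; as both have one, both
    notions come down to the zero of the common hom group. *)
Lemma full_zero_mor (X Y : S) (f : hom X Y) :
  zero_mor f <-> @zero_mor D (sval X) (sval Y) f.
Proof.
rewrite (zero_morE full_preadditive full_zero) (zero_morE A) //.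
by case: zP => Z []; exists Z.
Qed.

Lemma full_is_ker (X Y K : S) (f : hom X Y) (k : hom K X) :
  @is_ker D _ _ f _ k -> is_ker f k.
Proof.
move=> [fk u]; split; first exact/full_zero_mor.
by move=> T g /full_zero_mor; apply: u.
Qed.

Lemma full_is_coker (X Y Q : S) (f : hom X Y) (q : hom Y Q) :
  @is_coker D _ _ f _ q -> is_coker f q.
Proof.
move=> [fk u]; split; first exact/full_zero_mor.
by move=> T g /full_zero_mor; apply: u.
Qed.

(** A kernel in the subcategory is isomorphic to the ambient one, which already lies there, and
    being an ambient kernel is invariant under isomorphism. *)
Lemma full_preserves_kernels :
  (forall (X Y : S) (f : hom X Y),
    exists (K : S) (k : hom K X), @is_ker D _ _ f _ k) ->
  preserves_kernels (incl P).
Proof.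
move=> hk X Y f K k kk; have [K0 [k0 k0P]] := hk X Y f.
have [u [<- [v uv]]] := is_ker_unique (full_is_ker k0P) kk.
by apply: (is_ker_iso k0P); exists v.
Qed.

Lemma full_preserves_cokernels :
  (forall (X Y : S) (f : hom X Y),
    exists (Q : S) (q : hom Y Q), @is_coker D _ _ f _ q) ->
  preserves_cokernels (incl P).
Proof.
move=> hq X Y f Q q qq; have [Q0 [q0 q0P]] := hq X Y f.
have [u [<- [v [vu uv]]]] := @is_ker_unique (op S) Y X f Q0 q0 Q q
  ((op_is_ker _ _).2 (full_is_coker q0P)) ((op_is_ker _ _).2 qq).
apply/op_is_ker; apply: (@is_ker_iso (op D) (sval Y) (sval X) f (sval Q0) q0).
  exact/op_is_ker.
by exists v; split.
Qed.

End FullSubcategories.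

(** * The abelian category of mixed structures and its inclusion *)

Section MixedStructures.
Variables (L : porderZmodType) (hL : ordered_divisible_group L) (C : qacat).
Variables (r : rank_function C) (d : degree_function C L).
Hypothesis hmu : slope_function r d.
Local Notation Fun := (fun_cat (poset_cat L) C).
Local Notation M := (mixed_cat r d).

Lemma fun_zero : exists Z : Fun, is_zero Z.
Proof.
have [Z /(const_functor_zero (poset_cat L)) zZ] := qzero C.
by exists (const_functor _ Z).
Qed.

Lemma fun_is_ker (F G K : Fun) (f : nat_trans F G) (k : nat_trans K F) :
  (forall l, kr (f l) (k l)) -> @is_ker Fun _ _ f _ k.
Proof.
have zE := zero_morE (nt_preadditive (poset_cat L) C) fun_zero.
move=> kP; split.
  by apply/zE; apply: nat_trans_eq => l; case: (kP l).
move=> T g /zE e; apply: nt_kr_lift => // l.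
exact: (congr1 (fun t : nat_trans T G => t l) e).
Qed.

Lemma fun_is_coker (F G Q : Fun) (f : nat_trans F G) (q : nat_trans G Q) :
  (forall l, ck (f l) (q l)) -> @is_coker Fun _ _ f _ q.
Proof.
have zE := zero_morE (nt_preadditive (poset_cat L) C) fun_zero.
move=> qP; split.
  by apply/zE; apply: nat_trans_eq => l; case: (qP l).
move=> T g /zE e; apply: nt_ck_lift => // l.
exact: (congr1 (fun t : nat_trans F T => t l) e).
Qed.

Lemma common_breaks (X Y : M) :
  exists s, stepped r d s (sval X) /\ stepped r d s (sval Y).
Proof.
have [s sX] := mixed_stepped hL (svalP X).
have [s' sY] := mixed_stepped hL (svalP Y).
exists (s ++ s'); split.
  by apply: stepped_sub sX => x; rewrite mem_cat => ->.
by apply: stepped_sub sY => x; rewrite mem_cat orbC => ->.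
Qed.

Lemma mixed_zero : exists Z : Fun, is_zero Z /\ mixed r d Z.
Proof.
have [Z zZ] := fun_zero; exists Z; split=> //.
apply: (@stepped_mixed _ hL _ _ _ [::]).
by apply: stepped_zero => //; apply/functor_zeroP.
Qed.

Lemma mixed_kernel (X Y : M) (f : hom X Y) :
  exists (K : M) (k : hom K X), forall l, kr (ntc f l) (ntc k l).
Proof.
have [s [sX sY]] := common_breaks X Y.
have [K [k kP]] := nt_kernel (f : nat_trans _ _).
(* The cokernel is needed even here: the induction behind [stepped_kernel] controls morphisms into
   it. *)
have [Q [q qP]] := nt_cokernel (f : nat_trans _ _).
have mK := stepped_mixed hL (stepped_kernel hL hmu sX sY kP qP).
by exists (exist _ K mK), k.
Qed.

Lemma mixed_cokernel (X Y : M) (f : hom X Y) :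
  exists (Q : M) (q : hom Y Q), forall l, ck (ntc f l) (ntc q l).
Proof.
have [s [sX sY]] := common_breaks X Y.
have [K [k kP]] := nt_kernel (f : nat_trans _ _).
have [Q [q qP]] := nt_cokernel (f : nat_trans _ _).
have mQ := stepped_mixed hL (stepped_cokernel hL hmu sX sY kP qP).
by exists (exist _ Q mQ), q.
Qed.

Lemma mixed_qstrict (X Y : M) (f : hom X Y) l : qstrict (ntc f l).
Proof.
have [s [sX sY]] := common_breaks X Y.
have [K [k kP]] := nt_kernel (f : nat_trans _ _).
have [Q [q qP]] := nt_cokernel (f : nat_trans _ _).
by have [] := stepped_strict hL hmu sX sY kP qP l.
Qed.

Lemma mixed_is_ker (X Y K : M) (f : hom X Y) (k : hom K X) :
  (forall l, kr (ntc f l) (ntc k l)) -> is_ker f k.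
Proof.
by move=> /fun_is_ker; exact: (full_is_ker (nt_preadditive _ _) mixed_zero).
Qed.

Lemma mixed_is_coker (X Y Q : M) (f : hom X Y) (q : hom Y Q) :
  (forall l, ck (ntc f l) (ntc q l)) -> is_coker f q.
Proof.
by move=> /fun_is_coker; exact: (full_is_coker (nt_preadditive _ _) mixed_zero).
Qed.

Lemma mixed_additive : additive_category M.
Proof.
exists (full_preadditive _ (nt_preadditive (poset_cat L) C)); split.
  exact: full_zero mixed_zero.
move=> X Y; have [s [sX sY]] := common_breaks X Y.
have mS := stepped_mixed hL (stepped_biproduct hL sX sY).
pose B := nt_biproduct (sval X) (sval Y).
exists (exist _ (fbip (sval X) (sval Y)) mS).
exists (bin1 B), (bin2 B), (bpr1 B), (bpr2 B).
split; [exact (bpr1_in1 B) | exact (bpr2_in2 B) | exact (bpr1_in2 B)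
  | exact (bpr2_in1 B) | exact (bsumE B)].
Qed.

(** Coimage and image are formed level by level, so the comparison is invertible at each level by
    strictness there, and a levelwise invertible natural transformation is invertible. *)
Lemma mixed_strict (X Y : M) (f : hom X Y) : strict f.
Proof.
have [K [k kP]] := mixed_kernel f; have [I [p pP]] := mixed_cokernel k.
have [Q [q qP]] := mixed_cokernel f; have [J [i iP]] := mixed_kernel q.
have [|g [ig _]] := nt_kr_lift (x := f : nat_trans _ _) iP.
  by move=> l; case: (qP l).
have igl l : ntc i l \oc ntc g l = ntc f l by rewrite -ig.
have [|u [up _]] := nt_ck_lift (x := g) pP.
  move=> l; have [_ mi _] := iP l; apply: mi; rewrite compA igl comp0r.
  by case: (kP l).
have upl l : ntc u l \oc ntc p l = ntc g l by rewrite -up.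
have [|v [vu uv]] := nt_iso (t := u).
  move=> l.
  apply: qstrict_comparison (mixed_qstrict f l) (kP l) (pP l) (qP l) (iP l) _.
  by rewrite -compA upl igl.
exists K, k, I, p, Q, q, J, i, u; split.
- by split; [apply: mixed_is_ker | apply: mixed_is_coker].
- by split; [apply: mixed_is_coker | apply: mixed_is_ker].
- by apply: nat_trans_eq => l /=; rewrite -compA upl igl.
- by exists v.
Qed.

Lemma mixed_abelian : abelian M.
Proof.
split; [exact: mixed_additive| | |exact: mixed_strict].
  by move=> X Y f; have [K [k /mixed_is_ker]] := mixed_kernel f; exists K, k.
by move=> X Y f; have [Q [q /mixed_is_coker]] := mixed_cokernel f; exists Q, q.
Qed.

Lemma mixed_incl_kernels : preserves_kernels (mixed_incl r d).
Proof.
apply: (full_preserves_kernels (nt_preadditive _ _) mixed_zero) => X Y f.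
by have [K [k /fun_is_ker]] := mixed_kernel f; exists K, k.
Qed.

Lemma mixed_incl_cokernels : preserves_cokernels (mixed_incl r d).
Proof.
apply: (full_preserves_cokernels (nt_preadditive _ _) mixed_zero) => X Y f.
by have [Q [q /fun_is_coker]] := mixed_cokernel f; exists Q, q.
Qed.

End MixedStructures.

Theorem theoremB (L : porderZmodType) (hL : ordered_divisible_group L)
    (A : category) (hA : quasi_abelian A)
    (r : rank_function A) (d : degree_function A L)
    (hmu : slope_function r d) :
  abelian (mixed_cat r d) /\
  [/\ preserves_ses (mixed_incl r d),
      preserves_kernels (mixed_incl r d)
    & preserves_cokernels (mixed_incl r d)].
Proof.
have [C AC] := quasi_abelian_qacat hA; subst A.
have pk := mixed_incl_kernels hL hmu; have pc := mixed_incl_cokernels hL hmu.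
split; first exact: mixed_abelian.
split=> // X Y Z f g [/pk kf /pc cg].
by split.
Qed.
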